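(* For $\mu>0$, $u\ge0$ set $f_{\mu,u}(t)=\left(\mu S_{\mu}(t,u)\right)^{-1/\mu}-t^2$ for $t\in\mathbb{R}$, and $m_{\mu}(u)=\inf_{t\ge0}f_{\mu,u}(t)$, $M_{\mu}(u)=\sup_{t\ge0}f_{\mu,u}(t)$. Then $f_{\mu,u}(+\infty):=\lim_{t\to+\infty}f_{\mu,u}(t)=u^2+u+\frac16$, $0<m_\mu(u)\le M_\mu(u)<+\infty$, and, for real $a,b\ge0$, the inequality $$\frac{1}{\mu(t^2+a)^{\mu}}\le S_{\mu}(t,u)\le\frac{1}{\mu(t^2+b)^{\mu}}\quad\text{for all }t>0$$ holds if and only if $0\le b\le m_\mu(u)$ and $a\ge M_\mu(u)$. Moreover: (1) $u^2+u<m_\mu(u)\le u^2+u+\frac16<u^2+u+\frac14<M_\mu(u)<(1+u)^2$ for all $\mu>0$, $u\ge0$. (2) If $\nu>\mu>0$ and $u\ge0$, then $m_\nu(u)\le m_\mu(u)$ and $M_\nu(u)\ge M_\mu(u)$. (3) For every $\nu>0$, $u\ge0$ there exists $t_{\nu,u}\ge0$ such that $f'_{\nu,u}(t)<0$ for every $t>t_{\nu,u}$ and, consequently, $$\frac{1}{\nu(t^2+f_{\nu,u}(t_{\nu,u}))^{\nu}}<S_\nu(t,u)<\frac{1}{\nu(t^2+f_{\nu,u}(+\infty))^{\nu}}\quad\text{for all }t>t_{\nu,u}.$$ (4) Suppose that for some $\nu>0$, $u\ge0$ the inequality $$\left((\nu+1)S_{\nu+1}(t,u)\right)^{\frac1{\nu+1}}\le\left(\nu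 S_\nu(t,u)\right)^{\frac1\nu}$$ holds for all $t\ge0$. Then: (4.1) $f_{\nu,u}$ is strictly decreasing on $[0,+\infty)$; $\frac{1}{\nu(t^2+f_{\nu,u}(0))^{\nu}}<S_\nu(t,u)<\frac{1}{\nu(t^2+f_{\nu,u}(+\infty))^{\nu}}$ for all $t>0$; $M_\nu(u)=f_{\nu,u}(0)$; and for every $\mu\in(0,\nu+1]$ one has $m_\mu(u)=u^2+u+\frac16$ and $S_\mu(t,u)<\frac{1}{\mu(t^2+m_\mu(u))^{\mu}}$ for all $t\ge0$. (4.2) For every $0<\mu\le\nu$ and $0\le a\le u^2+u+\frac16$, $\frac{d}{dt}\left((t^2+a)^{\mu}S_\mu(t,u)\right)>0$ for all $t>0$. (5) (5.1) For every $\mu\in(0,2]$ one has $m_\mu(0)=\frac16$ and $S_\mu(t,0)<\frac{1}{\mu\left(t^2+\frac16\right)^{\mu}}$ for all $t\ge0$. (5.2) For every $0<\mu\le1$, $0\le a\le\frac16$ and $t>0$, $\frac{d}{dt}\left((t^2+a)^{\mu}S_\mu(t,0)\right)>0$.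
   Context: For $\mu>0$, $t\in\mathbb{R}$, $u\ge0$: $S_{\mu}(t,u):=\sum_{k=1}^{\infty}\frac{2(k+u)}{((k+u)^2+t^2)^{\mu+1}}$ (which is positive). The prime denotes the derivative in $t$. *)

(* Defs.v *)
From Stdlib Require Import Reals.
From Coquelicot Require Import Coquelicot.
Open Scope R_scope.

(* The summation index is shifted: the [k]-th term here is the one of index
   [k + 1] in the usual sum from 1. For [0 < mu] and [0 <= u] every base is at
   least 1, so [Rpower] is the genuine power, and the series converges. *)
Definition Ssum (mu t u : R) : R :=
  Series (fun k : nat =>
    2 * (INR (S k) + u) / Rpower ((INR (S k) + u) ^ 2 + t ^ 2) (mu + 1)).

Definition f_fun (mu u t : R) : R :=
  Rpower (mu * Ssum mu t u) (- (1 / mu)) - t ^ 2.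

Definition f_values (mu u : R) : R -> Prop :=
  fun y => exists t, 0 <= t /\ y = f_fun mu u t.

Definition m_inf (mu u : R) : Rbar := Glb_Rbar (f_values mu u).
Definition M_sup (mu u : R) : Rbar := Lub_Rbar (f_values mu u).

(* [f(+oo)]; [Lim] is total, existence of the limit has to be proved apart. *)
Definition f_infty (mu u : R) : R := real (Lim (f_fun mu u) p_infty).

(* Main.v *)
Require Import Defs.
From Stdlib Require Import Reals Factorial Lra Lia Psatz.
From Coquelicot Require Import Coquelicot.
Open Scope R_scope.

(** In the variable [s = t ^ 2], write [S_mu] for the series, [G_mu = (mu * S_mu) ^ (- 1 / mu)]
    and [F_mu = G_mu - s], so that [f t = F_mu (t ^ 2)]. The inequality with parameters
    [a] and [b] says exactly that [b <= F_mu <= a]. Termwise differentiation gives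
    [S_mu' = - (mu + 1) S_{mu+1}], whence [F_mu' = (G_mu / G_{mu+1}) ^ (mu + 1) - 1]
    ([is_derive_Ff]): [F_mu' <= 0] exactly where [G_mu <= G_{mu+1}].

    _Range._ The summand [2 y (y ^ 2 + s) ^ (- mu - 1)], with [y = k + u], is the midpoint
    rule for the integral of the convex function [w ^ (- mu - 1)] over the interval of centre
    [y ^ 2 + s] and half-length [y]. These intervals are adjacent, and the midpoint rule gives
    [F > u ^ 2 + u] ([Sg_midpoint]). The trapezoidal rule on the intervals between
    consecutive [y ^ 2 + s] gives [F < (1 + u) ^ 2] ([Sg_trapezoid]), and the midpoint rule in
    the variable [y] gives [F 0 > (u + 1 / 2) ^ 2] ([Sg_zero_midpoint]). Since the limit at
    infinity lies strictly between the first two bounds, so do the infimum and the supremum.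

    _Large t._ The Euler-Maclaurin formula ([Sg_em]) expands [ln G] in powers of
    [1 / (s + (u + 1 / 2) ^ 2)] up to the second order. The first order gives the limit of
    [F]; the second-order coefficient increases with [mu], so that [G_mu < G_{mu+1}] for large
    [s] ([Gf_lt_succ_eventually]) and [f] decreases there.

    _Dependence on the exponent._ For [mu < nu] the series [S_mu] is, up to a constant, the
    fractional integral [int_0^oo r ^ (nu - mu - 1) S_nu (s + r) dr] ([frac_int_Sg]), and the
    bound [(s + b) ^ (- mu) / mu] is obtained in the same way, with the same constant, from
    [(s + b) ^ (- nu) / nu]. Hence a bound of [F_nu] on the half-line is
    inherited by [F_mu]. The same operation lowers the exponent in the inequality
    [nu S_nu - (s + a) (nu + 1) S_{nu+1} > 0], which says that [(s + a) ^ nu S_nu] has a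
    positive derivative ([log_slope_descend]).

    _Comparison of consecutive exponents._ Let [G_nu <= G_{nu+1}] on the half-line. Then [F_nu]
    does not increase. If it were constant on an interval, then [F_{nu+1} = F_nu] there, and by
    induction all [F_{nu+n}] would take the same value, whereas [F_{nu+n}] tends to
    [(1 + u) ^ 2], because the first term of the series dominates, without reaching it
    ([Ff_strictly_decreasing]). Moreover [F_{nu+1} >= F_nu]
    stays above the limit, and fractional integration carries this down to all
    [mu <= nu + 1].

    _The exponents 1 and 2._ For [u = 0] one has [G_1 <= G_2], that is, [2 S_2 <= S_1 ^ 2].
    Rational functions obtained from the Euler-Maclaurin expansion, with one constant
    moved so that the error has a sign, bound the tails of both series by telescoping; what remains is a polynomial in [s] with positive coefficients
    ([Sg_2_le_sqr]). *)

(** * Negative powers *)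

Definition npow (q z : R) : R := Rpower z (- q).

Lemma npow_pos q z : 0 < npow q z.
Proof. apply exp_pos. Qed.

Lemma npow_plus q r z : npow (q + r) z = npow q z * npow r z.
Proof. unfold npow. rewrite <- Rpower_plus. f_equal; ring. Qed.

Lemma npow_1 z : 0 < z -> npow 1 z = / z.
Proof. intros Hz. unfold npow. rewrite Rpower_Ropp, Rpower_1; auto. Qed.

Lemma npow_succ q z : 0 < z -> npow (q + 1) z = npow q z / z.
Proof. intros Hz. rewrite npow_plus, npow_1; auto. Qed.

Lemma npow_nat n z : 0 < z -> npow (INR n) z = / z ^ n.
Proof. intros Hz. unfold npow. rewrite Rpower_Ropp, Rpower_pow; auto. Qed.

Lemma npow_inv q z : npow q z = / Rpower z q.
Proof. apply Rpower_Ropp. Qed.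

Lemma npow_mult_base q x y : 0 < x -> 0 < y -> npow q (x * y) = npow q x * npow q y.
Proof. intros Hx Hy. unfold npow. now rewrite Rpower_mult_distr. Qed.

Lemma npow_base_1 q : npow q 1 = 1.
Proof. unfold npow, Rpower. now rewrite ln_1, Rmult_0_r, exp_0. Qed.

Lemma npow_lt q z z' : 0 < q -> 0 < z < z' -> npow q z' < npow q z.
Proof.
  intros Hq Hz. unfold npow, Rpower. apply exp_increasing.
  assert (ln z < ln z') by (apply ln_increasing; lra). nra.
Qed.

Lemma npow_le q z z' : 0 < q -> 0 < z <= z' -> npow q z' <= npow q z.
Proof.
  intros Hq Hz. destruct (Rle_lt_or_eq_dec z z') as [H|H]; [lra| |subst; lra].
  left. apply npow_lt; lra.
Qed.

Lemma is_derive_npow q z : 0 < z -> is_derive (npow q) z (- q * npow (q + 1) z).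
Proof.
  intros Hz. unfold npow, Rpower.
  auto_derive; [lra|].
  replace (- (q + 1) * ln z) with (- q * ln z + - ln z) by ring.
  rewrite exp_plus, exp_Ropp, exp_ln by lra. field. lra.
Qed.

Lemma continuous_npow q z : 0 < z -> continuous (npow q) z.
Proof.
  intros Hz. apply (@ex_derive_continuous R_AbsRing R_NormedModule).
  eexists. now apply is_derive_npow.
Qed.

Lemma mean_value f f' a b :
  a < b -> (forall c, a <= c <= b -> is_derive f c (f' c)) ->
  exists c, f b - f a = f' c * (b - a) /\ a < c < b.
Proof.
  intros Hab Hd. apply MVT_cor2; auto.
  intros c Hc. apply is_derive_Reals. auto.
Qed.

Lemma npow_slope q z z' :
  0 < q -> 0 < z < z' ->
  q * (z' - z) * npow (q + 1) z' < npow q z - npow q z'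
  /\ npow q z - npow q z' < q * (z' - z) * npow (q + 1) z.
Proof.
  intros Hq Hz.
  destruct (mean_value (npow q) (fun z => - q * npow (q + 1) z) z z') as [c [Hc Hcz]].
  - lra.
  - intros c Hc. apply is_derive_npow. lra.
  - assert (H1 : npow (q + 1) z' < npow (q + 1) c) by (apply npow_lt; lra).
    assert (H2 : npow (q + 1) c < npow (q + 1) z) by (apply npow_lt; lra).
    assert (Hp : 0 < q * (z' - z)) by (apply Rmult_lt_0_compat; lra).
    split; nra.
Qed.

Lemma npow_convex q z w :
  0 < q -> 0 < w < z -> 2 * npow q z < npow q (z - w) + npow q (z + w).
Proof.
  intros Hq Hw.
  destruct (npow_slope q (z - w) z) as [H1 _]; [lra|lra|].
  destruct (npow_slope q z (z + w)) as [_ H2]; [lra|lra|].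
  replace (z - (z - w)) with w in H1 by ring.
  replace (z + w - z) with w in H2 by ring.
  lra.
Qed.

(** Midpoint rule for the convex function [npow (q + 1)], whose antiderivative
    is [- npow q / q]. *)
Lemma npow_midpoint q z y :
  0 < q -> 0 < y < z ->
  2 * y * q * npow (q + 1) z < npow q (z - y) - npow q (z + y).
Proof.
  intros Hq Hy.
  destruct (mean_value (fun w => npow q (z - w) - npow q (z + w) - 2 * w * q * npow (q + 1) z)
    (fun w => q * (npow (q + 1) (z - w) + npow (q + 1) (z + w) - 2 * npow (q + 1) z)) 0 y)
    as [c [Hc Hcy]].
  - lra.
  - intros c Hc.
    assert (D1 : is_derive (fun w => npow q (z - w)) c (-1 * (- q * npow (q + 1) (z - c)))).
    { apply (is_derive_comp (npow q) (fun w => z - w)).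
      - apply is_derive_npow. lra.
      - auto_derive; auto; ring. }
    assert (D2 : is_derive (fun w => npow q (z + w)) c (1 * (- q * npow (q + 1) (z + c)))).
    { apply (is_derive_comp (npow q) (fun w => z + w)).
      - apply is_derive_npow. lra.
      - auto_derive; auto; ring. }
    assert (D3 : is_derive (fun w => 2 * w * q * npow (q + 1) z) c (2 * q * npow (q + 1) z)).
    { auto_derive; auto; ring. }
    generalize (is_derive_minus _ _ _ _ _ (is_derive_minus _ _ _ _ _ D1 D2) D3).
    unfold minus, plus, opp; simpl. intros D.
    eapply is_derive_ext; [|eapply eq_rect; [exact D|]].
    + intros t; simpl; ring.
    + simpl; ring.
  - assert (Hconv := npow_convex (q + 1) z c).
    rewrite Rminus_0_r, Rplus_0_r, Rminus_0_r in Hc.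
    assert (0 < q * (npow (q + 1) (z - c) + npow (q + 1) (z + c) - 2 * npow (q + 1) z) * y).
    { apply Rmult_lt_0_compat; [|lra]. apply Rmult_lt_0_compat; [lra|].
      assert (2 * npow (q + 1) z < npow (q + 1) (z - c) + npow (q + 1) (z + c))
        by (apply Hconv; lra). lra. }
    lra.
Qed.

(** Trapezoidal rule for the same convex function. *)
Lemma npow_trapezoid q z z' :
  0 < q -> 0 < z < z' ->
  npow q z - npow q z' < q * (z' - z) / 2 * (npow (q + 1) z + npow (q + 1) z').
Proof.
  intros Hq Hz.
  destruct (mean_value
    (fun w => q / 2 * (w - z) * (npow (q + 1) z + npow (q + 1) w) + npow q w)
    (fun w => q / 2 * (npow (q + 1) z - npow (q + 1) w
                       - (q + 1) * (w - z) * npow (q + 1 + 1) w)) z z')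
    as [c [Hc Hcy]].
  - lra.
  - intros c Hc.
    assert (D1 := is_derive_npow (q + 1) c ltac:(lra)).
    assert (D2 := is_derive_npow q c ltac:(lra)).
    assert (D3 : is_derive (fun w => q / 2 * (w - z)) c (q / 2)).
    { auto_derive; auto; ring. }
    assert (D4 : is_derive (fun w => npow (q + 1) z + npow (q + 1) w) c
                   (0 + - (q + 1) * npow (q + 1 + 1) c)).
    { apply (is_derive_plus (fun _ => npow (q + 1) z)); auto.
      apply @is_derive_const. }
    generalize (is_derive_plus _ _ _ _ _ (is_derive_mult _ _ _ _ _ D3 D4 Rmult_comm) D2).
    unfold plus, mult; simpl. intros D.
    eapply is_derive_ext; [|eapply eq_rect; [exact D|]].
    + intros t; simpl; ring.
    + simpl. field.
  - destruct (npow_slope (q + 1) z c) as [H1 _]; [lra|lra|].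
    assert (0 < q / 2 * (npow (q + 1) z - npow (q + 1) c
                       - (q + 1) * (c - z) * npow (q + 1 + 1) c) * (z' - z)).
    { apply Rmult_lt_0_compat; [|lra]. apply Rmult_lt_0_compat; lra. }
    replace (z - z) with 0 in Hc by ring. lra.
Qed.

(** * Telescoping series *)

Lemma is_series_telescope (T : nat -> R) :
  is_lim_seq T 0 -> is_series (fun k => T k - T (S k)) (T 0%nat).
Proof.
  intros HT.
  change (is_lim_seq (sum_n (fun k => T k - T (S k))) (T 0%nat)).
  apply (is_lim_seq_ext (fun n => T 0%nat - T (S n))).
  - intros n. induction n as [|n IH].
    + now rewrite sum_O.
    + rewrite sum_Sn, <- IH. unfold plus; simpl. ring.
  - replace (Finite (T 0%nat)) with (Finite (T 0%nat - 0)) by (f_equal; ring).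
    apply is_lim_seq_minus'; [apply is_lim_seq_const|].
    now apply (is_lim_seq_incr_1 T).
Qed.

Lemma Series_lt (a b : nat -> R) :
  (forall k, 0 <= a k <= b k) -> a 0%nat < b 0%nat -> ex_series b ->
  Series a < Series b.
Proof.
  intros Hab H0 Hb.
  assert (Ha : ex_series a).
  { apply (@ex_series_le R_AbsRing R_CompleteNormedModule _ b); auto. intros n.
    change (Rabs (a n) <= b n). rewrite Rabs_pos_eq; apply Hab. }
  rewrite (Series_incr_1 a), (Series_incr_1 b) by auto.
  assert (Series (fun k => a (S k)) <= Series (fun k => b (S k))).
  { apply Series_le; [intros; apply Hab|]. now apply (ex_series_incr_1 b). }
  lra.
Qed.

Lemma Series_lt_telescope (a T : nat -> R) :
  (forall k, 0 <= a k < T k - T (S k)) -> is_lim_seq T 0 ->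
  ex_series a /\ Series a < T 0%nat.
Proof.
  intros Ha HT.
  assert (Hs := is_series_telescope T HT).
  assert (Hex : ex_series (fun k => T k - T (S k))) by now exists (T 0%nat).
  split.
  - apply (@ex_series_le R_AbsRing R_CompleteNormedModule _ (fun k => T k - T (S k))); auto.
    intros n. change (Rabs (a n) <= T n - T (S n)).
    destruct (Ha n). rewrite Rabs_pos_eq; lra.
  - rewrite <- (is_series_unique _ _ Hs). apply Series_lt; auto.
    + intros k. destruct (Ha k); lra.
    + apply Ha.
Qed.

Lemma Series_le_telescope (a T : nat -> R) :
  (forall k, 0 <= a k <= T k - T (S k)) -> is_lim_seq T 0 -> Series a <= T 0%nat.
Proof.
  intros Ha HT.
  assert (Hs := is_series_telescope T HT).
  rewrite <- (is_series_unique _ _ Hs). apply Series_le; auto.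
  now exists (T 0%nat).
Qed.

Lemma Series_ge_telescope (a T : nat -> R) :
  ex_series a -> (forall k, T k - T (S k) <= a k) -> is_lim_seq T 0 -> T 0%nat <= Series a.
Proof.
  intros Hex Ha HT.
  assert (Hs := is_series_telescope T HT).
  apply (is_lim_seq_le (sum_n (fun k => T k - T (S k))) (sum_n a) (T 0%nat) (Series a)).
  - intros n. apply sum_n_m_le. exact Ha.
  - exact Hs.
  - now apply Series_correct.
Qed.

Lemma is_lim_npow q : 0 < q -> is_lim (npow q) p_infty 0.
Proof.
  intros Hq. unfold npow, Rpower.
  apply (is_lim_comp exp (fun x => - q * ln x) p_infty 0 m_infty).
  - apply is_lim_exp_m.
  - evar_last.
    + apply is_lim_scal_l, is_lim_ln_p.
    + simpl. destruct (Rle_dec 0 (- q)) as [H|H]; [exfalso; lra|reflexivity].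
  - exists 0. intros; discriminate.
Qed.

Lemma is_lim_seq_npow q (z : nat -> R) :
  0 < q -> is_lim_seq z p_infty -> is_lim_seq (fun n => npow q (z n)) 0.
Proof.
  intros Hq Hz. apply (filterlim_comp _ _ _ z (npow q) _ (Rbar_locally' p_infty)).
  - exact Hz.
  - now apply is_lim_npow.
Qed.

(** * The series as a function of the squared variable *)

(** The nodes [k + u], [k >= 1], indexed from 0. *)
Definition pt (u : R) (k : nat) : R := INR (S k) + u.

Definition mterm (mu u s : R) (k : nat) : R :=
  2 * pt u k * npow (mu + 1) (pt u k ^ 2 + s).

Definition Sg (mu u s : R) : R := Series (mterm mu u s).

Lemma Ssum_Sg mu t u : Ssum mu t u = Sg mu u (t ^ 2).
Proof.
  apply Series_ext. intros k. unfold mterm, npow, pt, Rdiv. now rewrite Rpower_Ropp.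
Qed.

Lemma pt_ge u k : 0 <= u -> 1 <= pt u k.
Proof. intros Hu. unfold pt. rewrite S_INR. generalize (pos_INR k). lra. Qed.

Lemma pt_ge_first u k : 1 + u <= pt u k.
Proof. unfold pt. rewrite S_INR. generalize (pos_INR k). lra. Qed.

Lemma pt_0 u : pt u 0 = 1 + u.
Proof. unfold pt. simpl. ring. Qed.

Lemma pt_S u k : pt u (S k) = pt u k + 1.
Proof. unfold pt. rewrite !S_INR. ring. Qed.

Lemma mterm_pos mu u s k : 0 <= u -> 0 < mterm mu u s k.
Proof.
  intros Hu. unfold mterm. generalize (pt_ge u k Hu) (npow_pos (mu + 1) (pt u k ^ 2 + s)).
  intros. apply Rmult_lt_0_compat; lra.
Qed.

Lemma mterm_shift mu u s k : mterm mu u s (S k) = mterm mu (u + 1) s k.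
Proof.
  unfold mterm. replace (pt (u + 1) k) with (pt u (S k)); auto.
  unfold pt. rewrite !S_INR. ring.
Qed.

Lemma is_lim_seq_pt u : is_lim_seq (pt u) p_infty.
Proof.
  unfold pt. eapply is_lim_seq_plus.
  - apply (is_lim_seq_incr_1 INR). apply is_lim_seq_INR.
  - apply is_lim_seq_const.
  - reflexivity.
Qed.

(** Midpoint rule: the intervals [pt k ^ 2 + s +- pt k] are adjacent, the first one starting
    at [s + u ^ 2 + u]. *)
Lemma Sg_midpoint mu u s :
  0 < mu -> 0 <= u -> 0 <= s -> 0 < s + (u ^ 2 + u) ->
  ex_series (mterm mu u s) /\ Sg mu u s < npow mu (s + (u ^ 2 + u)) / mu.
Proof.
  intros Hmu Hu Hs Hsu.
  set (T := fun k => npow mu (s + (pt u k ^ 2 - pt u k)) / mu).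
  replace (npow mu (s + (u ^ 2 + u)) / mu) with (T 0%nat).
  2: { unfold T. rewrite pt_0. do 2 f_equal. ring. }
  apply Series_lt_telescope.
  - intros k. split; [left; now apply mterm_pos|].
    assert (Hp := pt_ge u k Hu).
    assert (HM : 2 * pt u k * mu * npow (mu + 1) (pt u k ^ 2 + s)
      < npow mu (pt u k ^ 2 + s - pt u k) - npow mu (pt u k ^ 2 + s + pt u k)).
    { apply npow_midpoint; auto. split; [lra|].
      assert (Hk := pt_ge_first u k).
      nra. }
    unfold T, mterm. rewrite pt_S.
    replace (s + ((pt u k + 1) ^ 2 - (pt u k + 1))) with (pt u k ^ 2 + s + pt u k) by ring.
    replace (s + (pt u k ^ 2 - pt u k)) with (pt u k ^ 2 + s - pt u k) by ring.
    apply (Rmult_lt_reg_r mu); auto. field_simplify; [|lra]. lra.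
  - replace (Finite 0) with (Finite (0 * / mu)) by (f_equal; ring).
    apply is_lim_seq_mult'; [|apply is_lim_seq_const].
    apply is_lim_seq_npow; auto.
    apply (is_lim_seq_le_p_loc (pt u)); [|apply is_lim_seq_pt].
    exists 1%nat. intros k Hk.
    assert (INR 1 <= INR k) by (now apply le_INR). simpl in H.
    assert (pt u k >= 2) by (unfold pt; rewrite S_INR; lra). nra.
Qed.

Lemma ex_series_mterm mu u s :
  0 < mu -> 0 <= u -> - (1 / 2) <= s -> ex_series (mterm mu u s).
Proof.
  intros Hmu Hu Hs.
  apply (@ex_series_le R_AbsRing R_CompleteNormedModule _
           (fun k => npow (mu + 1) (1 / 2) * mterm mu u 0 k)).
  - intros k. change (Rabs (mterm mu u s k) <= npow (mu + 1) (1 / 2) * mterm mu u 0 k).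
    rewrite Rabs_pos_eq by (left; now apply mterm_pos).
    unfold mterm. assert (Hp := pt_ge u k Hu).
    assert (Hn : npow (mu + 1) (pt u k ^ 2 + s)
                 <= npow (mu + 1) (1 / 2) * npow (mu + 1) (pt u k ^ 2 + 0)).
    { rewrite <- npow_mult_base by nra. apply npow_le; [lra|]. nra. }
    nra.
  - apply (@ex_series_scal R_AbsRing R_NormedModule).
    apply ex_series_incr_1.
    apply (ex_series_ext (mterm mu (u + 1) 0)).
    + intros k. now rewrite mterm_shift.
    + apply Sg_midpoint; try lra. nra.
Qed.

Lemma Sg_shift mu u s :
  0 < mu -> 0 <= u -> - (1 / 2) <= s -> Sg mu u s = mterm mu u s 0 + Sg mu (u + 1) s.
Proof.
  intros Hmu Hu Hs. unfold Sg. rewrite Series_incr_1 by (now apply ex_series_mterm).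
  f_equal. apply Series_ext. intros k. apply mterm_shift.
Qed.

Lemma Sg_nonneg mu u s : 0 < mu -> 0 <= u -> - (1 / 2) <= s -> 0 <= Sg mu u s.
Proof.
  intros Hmu Hu Hs.
  rewrite <- (Rmult_0_l (Series (mterm mu u s))), <- Series_scal_l.
  apply Series_le; [|now apply ex_series_mterm].
  intros k. generalize (mterm_pos mu u s k Hu). lra.
Qed.

Lemma Sg_pos mu u s : 0 < mu -> 0 <= u -> - (1 / 2) <= s -> 0 < Sg mu u s.
Proof.
  intros Hmu Hu Hs. rewrite Sg_shift by auto.
  assert (H1 := mterm_pos mu u s 0 Hu).
  assert (H2 := Sg_nonneg mu (u + 1) s Hmu ltac:(lra) Hs). lra.
Qed.

(** Chord slopes between tangent slopes, termwise: the differentiability of the series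
    follows from this squeeze instead of uniform convergence. *)
Lemma Sg_slope mu u s s' :
  0 < mu -> 0 <= u -> - (1 / 2) <= s < s' ->
  (mu + 1) * (s' - s) * Sg (mu + 1) u s' <= Sg mu u s - Sg mu u s'
  /\ Sg mu u s - Sg mu u s' <= (mu + 1) * (s' - s) * Sg (mu + 1) u s.
Proof.
  intros Hmu Hu Hs.
  assert (Hterm : forall k,
    (mu + 1) * (s' - s) * mterm (mu + 1) u s' k <= mterm mu u s k - mterm mu u s' k
    /\ mterm mu u s k - mterm mu u s' k <= (mu + 1) * (s' - s) * mterm (mu + 1) u s k).
  { intros k. assert (Hp := pt_ge u k Hu). unfold mterm.
    destruct (npow_slope (mu + 1) (pt u k ^ 2 + s) (pt u k ^ 2 + s')) as [H1 H2];
      [lra|nra|].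
    replace (pt u k ^ 2 + s' - (pt u k ^ 2 + s)) with (s' - s) in H1, H2 by ring.
    split; nra. }
  assert (E0 := ex_series_mterm mu u s Hmu Hu ltac:(lra)).
  assert (E1 := ex_series_mterm mu u s' Hmu Hu ltac:(lra)).
  assert (E2 := ex_series_mterm (mu + 1) u s ltac:(lra) Hu ltac:(lra)).
  assert (Ed : ex_series (fun k => mterm mu u s k - mterm mu u s' k))
    by (now apply (@ex_series_minus R_AbsRing R_NormedModule)).
  unfold Sg. rewrite <- Series_minus, <- !Series_scal_l by auto. split.
  - apply Series_le; auto. intros k. split; [|apply Hterm].
    apply Rmult_le_pos; [nra|]. left; now apply mterm_pos.
  - apply Series_le; [|now apply (@ex_series_scal R_AbsRing R_NormedModule)].
    intros k. split; [|apply Hterm].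
    eapply Rle_trans; [|apply Hterm].
    apply Rmult_le_pos; [nra|]. left; now apply mterm_pos.
Qed.

Lemma Sg_decr mu u s s' :
  0 < mu -> 0 <= u -> - (1 / 2) <= s <= s' -> Sg mu u s' <= Sg mu u s.
Proof.
  intros Hmu Hu Hs. destruct (Rle_lt_or_eq_dec s s') as [H|H]; [lra| |subst; lra].
  destruct (Sg_slope mu u s s') as [H1 _]; auto; [lra|].
  assert (0 <= (mu + 1) * (s' - s) * Sg (mu + 1) u s').
  { apply Rmult_le_pos; [nra|]. apply Sg_nonneg; lra. }
  lra.
Qed.

Lemma Sg_lipschitz mu u s s' :
  0 < mu -> 0 <= u -> - (1 / 2) <= s -> - (1 / 2) <= s' ->
  Rabs (Sg mu u s - Sg mu u s') <= (mu + 1) * Sg (mu + 1) u (- (1 / 2)) * Rabs (s - s').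
Proof.
  intros Hmu Hu.
  assert (Hlt : forall s s', - (1 / 2) <= s < s' ->
    Rabs (Sg mu u s - Sg mu u s') <= (mu + 1) * Sg (mu + 1) u (- (1 / 2)) * Rabs (s - s')).
  { clear s s'. intros s s' Hs.
    destruct (Sg_slope mu u s s') as [H1 H2]; auto.
    assert (H3 := Sg_decr (mu + 1) u (- (1 / 2)) s ltac:(lra) Hu ltac:(lra)).
    assert (H4 := Sg_nonneg (mu + 1) u s' ltac:(lra) Hu ltac:(lra)).
    rewrite Rabs_pos_eq, Rabs_left.
    - assert ((mu + 1) * (s' - s) * Sg (mu + 1) u s
              <= (mu + 1) * (s' - s) * Sg (mu + 1) u (- (1 / 2)))
        by (apply Rmult_le_compat_l; [nra|auto]). lra.
    - lra.
    - assert (0 <= (mu + 1) * (s' - s) * Sg (mu + 1) u s') by (apply Rmult_le_pos; [nra|auto]).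
      lra. }
  intros Hs Hs'. destruct (Rtotal_order s s') as [H|[H|H]].
  - apply Hlt; lra.
  - subst. rewrite !Rminus_diag, Rabs_R0. lra.
  - rewrite Rabs_minus_sym, (Rabs_minus_sym s). apply Hlt; lra.
Qed.

Lemma is_derive_Sg mu u s :
  0 < mu -> 0 <= u -> - (1 / 2) < s ->
  is_derive (Sg mu u) s (- (mu + 1) * Sg (mu + 1) u s).
Proof.
  intros Hmu Hu Hs. apply is_derive_Reals. intros eps Heps.
  set (L := (mu + 1) * ((mu + 1 + 1) * Sg (mu + 1 + 1) u (- (1 / 2)))).
  assert (HL : 0 <= L).
  { unfold L. apply Rmult_le_pos; [lra|]. apply Rmult_le_pos; [lra|].
    apply Sg_nonneg; lra. }
  assert (Hd : 0 < Rmin (s + 1 / 2) (eps / (L + 1))).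
  { apply Rmin_pos; [lra|]. apply Rdiv_lt_0_compat; lra. }
  exists (mkposreal _ Hd). simpl. intros h Hh Hhd.
  assert (Hh1 : Rabs h < s + 1 / 2) by (eapply Rlt_le_trans; [exact Hhd|apply Rmin_l]).
  assert (Hh2 : Rabs h < eps / (L + 1)) by (eapply Rlt_le_trans; [exact Hhd|apply Rmin_r]).
  assert (Hlip : Rabs (Sg (mu + 1) u s - Sg (mu + 1) u (s + h))
    <= (mu + 1 + 1) * Sg (mu + 1 + 1) u (- (1 / 2)) * Rabs (s - (s + h))).
  { apply Sg_lipschitz; try lra. apply Rabs_def2 in Hh1. lra. }
  replace (s - (s + h)) with (- h) in Hlip by ring. rewrite Rabs_Ropp in Hlip.
  (* Both bounds of [Sg_slope] are within [L * Rabs h] of the limit slope. *)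
  assert (Hq : Rabs ((Sg mu u (s + h) - Sg mu u s) / h - - (mu + 1) * Sg (mu + 1) u s)
               <= L * Rabs h).
  { eapply Rle_trans with ((mu + 1) * Rabs (Sg (mu + 1) u s - Sg (mu + 1) u (s + h))).
    2: { unfold L. assert (0 < mu + 1) by lra. nra. }
    set (A := Sg (mu + 1) u s) in *. set (B := Sg (mu + 1) u (s + h)) in *.
    rewrite <- (Rabs_pos_eq (mu + 1)) at 2 by lra. rewrite <- Rabs_mult.
    set (Q := (Sg mu u (s + h) - Sg mu u s) / h).
    assert (HQ : Q * h = Sg mu u (s + h) - Sg mu u s) by (unfold Q; field; auto).
    apply Rabs_def2 in Hh1.
    destruct (Rtotal_order h 0) as [H|[H|H]]; [|lra|].
    - destruct (Sg_slope mu u (s + h) s) as [H1 H2]; auto; [lra|].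
      fold A in H1. fold B in H2.
      assert (K1 : (mu + 1) * A <= - Q) by nra.
      assert (K2 : - Q <= (mu + 1) * B) by nra.
      rewrite Rabs_left1 by lra. rewrite Rabs_left1 by nra. lra.
    - destruct (Sg_slope mu u s (s + h)) as [H1 H2]; auto; [lra|].
      fold B in H1. fold A in H2.
      assert (K1 : (mu + 1) * B <= - Q) by nra.
      assert (K2 : - Q <= (mu + 1) * A) by nra.
      rewrite Rabs_pos_eq by lra. rewrite Rabs_pos_eq by nra. lra. }
  eapply Rle_lt_trans; [exact Hq|].
  apply Rle_lt_trans with ((L + 1) * Rabs h).
  - generalize (Rabs_pos h). nra.
  - apply (Rmult_lt_compat_l (L + 1)) in Hh2; [|lra].
    replace ((L + 1) * (eps / (L + 1))) with eps in Hh2 by (field; lra). lra.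
Qed.

Lemma continuous_Sg mu u s :
  0 < mu -> 0 <= u -> - (1 / 2) < s -> continuous (Sg mu u) s.
Proof.
  intros Hmu Hu Hs. apply (@ex_derive_continuous R_AbsRing R_NormedModule).
  eexists. now apply is_derive_Sg.
Qed.

(** Trapezoidal rule on the intervals between consecutive [pt k ^ 2 + s]; the weights
    add up to [2 * pt k], except at the first node, where they add up to less. *)
Lemma Sg_trapezoid mu u s :
  0 < mu -> 0 <= u -> 0 <= s -> npow mu (s + (1 + u) ^ 2) / mu < Sg mu u s.
Proof.
  intros Hmu Hu Hs.
  (* The correction hands the right half of each trapezoid over to the next step, which
     has the same node as its left end. *)
  set (T := fun k => npow mu (s + pt u k ^ 2) / mu
                     + (pt u k - 1 / 2) * npow (mu + 1) (s + pt u k ^ 2)).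
  assert (Hle : T 0%nat <= Sg mu u s).
  { apply Series_ge_telescope.
    - apply ex_series_mterm; lra.
    - intros k. assert (Hp := pt_ge u k Hu).
      assert (HM := npow_trapezoid mu (s + pt u k ^ 2) (s + pt u (S k) ^ 2) Hmu).
      rewrite pt_S in HM.
      specialize (HM ltac:(nra)).
      replace (s + (pt u k + 1) ^ 2 - (s + pt u k ^ 2)) with (2 * pt u k + 1) in HM by ring.
      unfold T, mterm. rewrite pt_S, (Rplus_comm (pt u k ^ 2) s).
      apply (Rmult_le_reg_r mu); auto. field_simplify; [|lra]. lra.
    - assert (L1 : is_lim_seq (fun k => npow mu (s + pt u k ^ 2)) 0).
      { apply is_lim_seq_npow; auto.
        apply (is_lim_seq_le_p_loc (pt u)); [|apply is_lim_seq_pt].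
        exists 0%nat. intros k _. generalize (pt_ge u k Hu). nra. }
      replace (Finite 0) with (Finite (0 * / mu + 0)) by (f_equal; ring).
      apply is_lim_seq_plus'.
      + apply is_lim_seq_mult'; [exact L1|apply is_lim_seq_const].
      + apply (is_lim_seq_le_le (fun _ => 0) _ (fun k => npow mu (s + pt u k ^ 2))); auto.
        2: apply is_lim_seq_const.
        intros k. assert (Hp := pt_ge u k Hu).
        assert (Hn := npow_pos (mu + 1) (s + pt u k ^ 2)).
        split; [apply Rmult_le_pos; lra|].
        assert (Hs1 : 0 < s + pt u k ^ 2) by nra.
        rewrite (npow_succ mu) by lra.
        assert (Hn' := npow_pos mu (s + pt u k ^ 2)).
        replace ((pt u k - 1 / 2) * (npow mu (s + pt u k ^ 2) / (s + pt u k ^ 2)))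
          with (npow mu (s + pt u k ^ 2) * ((pt u k - 1 / 2) / (s + pt u k ^ 2)))
          by (field; lra).
        rewrite <- Rmult_1_r. apply Rmult_le_compat_l; [lra|].
        apply Rle_div_l; nra. }
  eapply Rlt_le_trans; [|exact Hle].
  unfold T. rewrite pt_0.
  assert (0 < (1 + u - 1 / 2) * npow (mu + 1) (s + (1 + u) ^ 2)).
  { apply Rmult_lt_0_compat; [lra|apply npow_pos]. }
  lra.
Qed.

(** At [s = 0] the midpoint rule applies to the variable [y] itself, since the term
    is [2 * y ^ (- 2 mu - 1)]. *)
Lemma Sg_zero_midpoint mu u :
  0 < mu -> 0 <= u -> mu * Sg mu u 0 < npow mu ((u + 1 / 2) ^ 2).
Proof.
  intros Hmu Hu.
  assert (Hsq : forall q x, 0 < x -> npow q (x ^ 2) = npow (2 * q) x).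
  { intros q x Hx. replace (x ^ 2) with (x * x) by ring.
    rewrite npow_mult_base, <- npow_plus by auto. f_equal. ring. }
  rewrite Hsq by lra.
  set (T := fun k => npow (2 * mu) (pt u k - 1 / 2)).
  replace (npow (2 * mu) (u + 1 / 2)) with (T 0%nat).
  2: { unfold T. rewrite pt_0. f_equal. field. }
  unfold Sg. rewrite <- Series_scal_l.
  apply Series_lt_telescope.
  - intros k. assert (Hp := pt_ge u k Hu). split.
    + apply Rmult_le_pos; [lra|]. left; now apply mterm_pos.
    + assert (HM := npow_midpoint (2 * mu) (pt u k) (1 / 2) ltac:(lra) ltac:(lra)).
      unfold T, mterm. rewrite pt_S, Rplus_0_r, Hsq by lra.
      replace (pt u k + 1 - 1 / 2) with (pt u k + 1 / 2) by field.
      replace (2 * (mu + 1)) with (2 * mu + 1 + 1) by ring.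
      rewrite (npow_succ (2 * mu + 1)) by lra.
      eapply Rle_lt_trans; [|exact HM]. right. field. lra.
  - apply is_lim_seq_npow; [lra|].
    eapply is_lim_seq_minus; [apply is_lim_seq_pt|apply is_lim_seq_const|reflexivity].
Qed.

(** * The function [F] and its derivative *)

Definition Gf (mu u s : R) : R := npow (1 / mu) (mu * Sg mu u s).
Definition Ff (mu u s : R) : R := Gf mu u s - s.

Lemma f_fun_Ff mu u t : f_fun mu u t = Ff mu u (t ^ 2).
Proof. unfold f_fun, Ff, Gf. now rewrite Ssum_Sg. Qed.

Lemma Gf_pos mu u s : 0 < Gf mu u s.
Proof. apply npow_pos. Qed.

Lemma npow_npow p q z : npow p (npow q z) = Rpower z (q * p).
Proof. unfold npow. rewrite Rpower_mult. f_equal. ring. Qed.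

Lemma npow_Gf mu u s :
  0 < mu -> 0 <= u -> - (1 / 2) <= s -> npow mu (Gf mu u s) = mu * Sg mu u s.
Proof.
  intros Hmu Hu Hs. unfold Gf. rewrite npow_npow.
  replace (1 / mu * mu) with 1 by (field; lra).
  apply Rpower_1. assert (H := Sg_pos mu u s Hmu Hu Hs). now apply Rmult_lt_0_compat.
Qed.

Lemma npow_lt_inv q z z' : 0 < q -> 0 < z -> 0 < z' -> npow q z' < npow q z -> z < z'.
Proof.
  intros Hq Hz Hz' H. destruct (Rlt_le_dec z z'); auto.
  assert (npow q z <= npow q z') by (apply npow_le; lra). lra.
Qed.

Lemma Ff_lt_iff mu u s a :
  0 < mu -> 0 <= u -> - (1 / 2) <= s -> 0 < s + a ->
  (Ff mu u s < a <-> npow mu (s + a) / mu < Sg mu u s).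
Proof.
  intros Hmu Hu Hs Ha. unfold Ff. assert (HG := Gf_pos mu u s).
  assert (E := npow_Gf mu u s Hmu Hu Hs).
  assert (E' : Sg mu u s = npow mu (Gf mu u s) / mu) by (rewrite E; field; lra).
  rewrite E'. split; intros H.
  - apply Rmult_lt_compat_r; [now apply Rinv_0_lt_compat|]. apply npow_lt; lra.
  - assert (Gf mu u s < s + a); [|lra]. apply (npow_lt_inv mu); auto.
    apply (Rmult_lt_reg_r (/ mu)); auto. now apply Rinv_0_lt_compat.
Qed.

Lemma Ff_gt_iff mu u s b :
  0 < mu -> 0 <= u -> - (1 / 2) <= s -> 0 < s + b ->
  (b < Ff mu u s <-> Sg mu u s < npow mu (s + b) / mu).
Proof.
  intros Hmu Hu Hs Hb. unfold Ff. assert (HG := Gf_pos mu u s).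
  assert (E := npow_Gf mu u s Hmu Hu Hs).
  assert (E' : Sg mu u s = npow mu (Gf mu u s) / mu) by (rewrite E; field; lra).
  rewrite E'. split; intros H.
  - apply Rmult_lt_compat_r; [now apply Rinv_0_lt_compat|]. apply npow_lt; lra.
  - assert (s + b < Gf mu u s); [|lra]. apply (npow_lt_inv mu); auto.
    apply (Rmult_lt_reg_r (/ mu)); auto. now apply Rinv_0_lt_compat.
Qed.

Lemma bound_npow mu x : 1 / (mu * Rpower x mu) = npow mu x / mu.
Proof. rewrite npow_inv. unfold Rdiv. rewrite Rinv_mult. ring. Qed.

Lemma Ff_le_iff mu u s a :
  0 < mu -> 0 <= u -> - (1 / 2) <= s -> 0 < s + a ->
  (Ff mu u s <= a <-> npow mu (s + a) / mu <= Sg mu u s).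
Proof.
  intros Hmu Hu Hs Ha. destruct (Ff_gt_iff mu u s a) as [H1 H2]; auto. split; intros H.
  - destruct (Rle_lt_dec (npow mu (s + a) / mu) (Sg mu u s)); auto.
    assert (a < Ff mu u s) by auto. lra.
  - destruct (Rle_lt_dec (Ff mu u s) a); auto.
    assert (Sg mu u s < npow mu (s + a) / mu) by auto. lra.
Qed.

Lemma Ff_ge_iff mu u s b :
  0 < mu -> 0 <= u -> - (1 / 2) <= s -> 0 < s + b ->
  (b <= Ff mu u s <-> Sg mu u s <= npow mu (s + b) / mu).
Proof.
  intros Hmu Hu Hs Ha. destruct (Ff_lt_iff mu u s b) as [H1 H2]; auto. split; intros H.
  - destruct (Rle_lt_dec (Sg mu u s) (npow mu (s + b) / mu)); auto.
    assert (Ff mu u s < b) by auto. lra.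
  - destruct (Rle_lt_dec b (Ff mu u s)); auto.
    assert (npow mu (s + b) / mu < Sg mu u s) by auto. lra.
Qed.

Lemma Ff_gt_low mu u s : 0 < mu -> 0 <= u -> 0 <= s -> u ^ 2 + u < Ff mu u s.
Proof.
  intros Hmu Hu Hs. assert (Hw : 0 <= s + (u ^ 2 + u)) by nra.
  destruct (Rle_lt_or_eq_dec _ _ Hw) as [H|H].
  - apply Ff_gt_iff; auto; [lra|]. now apply Sg_midpoint.
  - assert (s = 0) by nra. unfold Ff. generalize (Gf_pos mu u s). lra.
Qed.

Lemma Ff_lt_high mu u s : 0 < mu -> 0 <= u -> 0 <= s -> Ff mu u s < (1 + u) ^ 2.
Proof.
  intros Hmu Hu Hs. apply Ff_lt_iff; auto; [lra|nra|]. now apply Sg_trapezoid.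
Qed.

Lemma Ff_zero_gt mu u : 0 < mu -> 0 <= u -> u ^ 2 + u + 1 / 4 < Ff mu u 0.
Proof.
  intros Hmu Hu. replace (u ^ 2 + u + 1 / 4) with ((u + 1 / 2) ^ 2) by field.
  apply Ff_gt_iff; auto; [lra|nra|]. rewrite Rplus_0_l.
  apply (Rmult_lt_reg_l mu); auto.
  replace (mu * (npow mu ((u + 1 / 2) ^ 2) / mu)) with (npow mu ((u + 1 / 2) ^ 2))
    by (field; lra).
  now apply Sg_zero_midpoint.
Qed.

(** Differentiating in [s] raises the exponent by one, so that the sign of [F'] is
    decided by comparing [G] at two consecutive exponents. *)
Lemma is_derive_Ff mu u s :
  0 < mu -> 0 <= u -> - (1 / 2) < s ->
  is_derive (Ff mu u) s (npow (mu + 1) (Gf (mu + 1) u s / Gf mu u s) - 1).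
Proof.
  intros Hmu Hu Hs.
  assert (HS := Sg_pos mu u s Hmu Hu ltac:(lra)).
  assert (HmS : 0 < mu * Sg mu u s) by (now apply Rmult_lt_0_compat).
  assert (D1 : is_derive (fun s => mu * Sg mu u s) s (mu * (- (mu + 1) * Sg (mu + 1) u s))).
  { apply is_derive_scal. now apply is_derive_Sg. }
  assert (D2 := is_derive_npow (1 / mu) (mu * Sg mu u s) HmS).
  assert (D3 := is_derive_comp (npow (1 / mu)) (fun s => mu * Sg mu u s) s _ _ D2 D1).
  assert (D4 : is_derive (fun s : R => s) s 1) by apply @is_derive_id.
  generalize (is_derive_minus _ _ _ _ _ D3 D4).
  unfold minus, plus, opp, scal; simpl. unfold mult; simpl. intros D.
  eapply is_derive_ext; [|eapply eq_rect; [exact D|]].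
  - intros t; simpl; unfold Ff, Gf; ring.
  - simpl. unfold Rminus at 1. apply Rplus_eq_compat_r.
    assert (HG := Gf_pos mu u s). assert (HG1 := Gf_pos (mu + 1) u s).
    change (Gf (mu + 1) u s / Gf mu u s) with (Gf (mu + 1) u s * / Gf mu u s).
    rewrite (npow_mult_base (mu + 1)) by (auto; now apply Rinv_0_lt_compat).
    rewrite (npow_Gf (mu + 1)) by lra.
    replace (npow (mu + 1) (/ Gf mu u s)) with (npow (1 / mu + 1) (mu * Sg mu u s)).
    + field. lra.
    + unfold Gf, npow. rewrite <- Rpower_Ropp, !Rpower_mult. f_equal. field. lra.
Qed.

Lemma npow_ratio_lt q x y : 0 < q -> 0 < x -> 0 < y -> (npow q (y / x) - 1 < 0 <-> x < y).
Proof.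
  intros Hq Hx Hy.
  assert (E := npow_base_1 q).
  assert (Hyx : 0 < y / x) by (now apply Rdiv_lt_0_compat).
  split; intros H.
  - assert (1 < y / x) by (apply (npow_lt_inv q); lra).
    apply (Rmult_lt_reg_r (/ x)); [now apply Rinv_0_lt_compat|]. rewrite Rinv_r; lra.
  - assert (npow q (y / x) < npow q 1); [|lra]. apply npow_lt; auto. split; [lra|].
    apply (Rmult_lt_reg_r x); auto. field_simplify; lra.
Qed.

Lemma npow_ratio_le q x y : 0 < q -> 0 < x -> 0 < y -> x <= y -> npow q (y / x) - 1 <= 0.
Proof.
  intros Hq Hx Hy H. destruct (Rle_lt_or_eq_dec _ _ H) as [H'|H'].
  - left. now apply npow_ratio_lt.
  - subst. replace (y / y) with 1 by (field; lra).
    rewrite npow_base_1. lra.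
Qed.

(** * The inequality [2 S_2 <= S_1 ^ 2] for [u = 0] *)

(** [low1 y] and [upp2 y] approximate the tails [k >= y] of [S_1] and of [2 * S_2] (for
    [u = 0]). In terms of [w = y (y - 1)] and [Z = s + w], the Euler-Maclaurin expansion of the
    first tail begins with
    [1 / Z - (1 / 6) / Z ^ 2 - (w / 3 + 1 / 30) / Z ^ 3 - (w / 10 + 1 / 42) / Z ^ 4
     + (7 / 15) w ^ 2 / Z ^ 5],
    and the second tail is minus its derivative in [Z]. Replacing [1 / 42] by [1 / 2] in
    [low1], and by [- 1 / 2] in [upp2], gives the error of each telescoping step a sign. *)
Definition low1 (y s : R) : R :=
  let w := y * (y - 1) in let Z := s + w in
  (30 * Z ^ 4 - 5 * Z ^ 3 - (10 * w + 1) * Z ^ 2 - (3 * w + 15) * Z + 14 * w ^ 2)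
  / (30 * Z ^ 5).

Definition upp2 (y s : R) : R :=
  let w := y * (y - 1) in let Z := s + w in
  (30 * Z ^ 4 - 10 * Z ^ 3 - (30 * w + 3) * Z ^ 2 - (12 * w - 60) * Z + 70 * w ^ 2)
  / (30 * Z ^ 6).

(** Proves [0 <= P] for a polynomial [P] with nonnegative coefficients in nonnegative
    variables. *)
Ltac nonneg_poly :=
  ring_simplify;
  repeat match goal with
  | |- 0 <= _ + _ => apply Rplus_le_le_0_compat
  | |- 0 <= _ * _ => apply Rmult_le_pos
  | |- 0 <= _ ^ _ => apply pow_le
  | _ => lra
  end.

Lemma frac_diff_le A B C a b z : 0 < a -> 0 < b -> 0 < z ->
  0 <= C * (a * b) - (A * b - B * a) * z -> A / a - B / b <= C / z.
Proof.
  intros Ha Hb Hz H.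
  apply Rminus_le_0.
  replace (C / z - (A / a - B / b)) with ((C * (a * b) - (A * b - B * a) * z) / (a * b * z))
    by (field; lra).
  apply Rdiv_le_0_compat; auto. repeat apply Rmult_lt_0_compat; auto.
Qed.

Lemma low1_step y s : 2 <= y -> 0 <= s ->
  low1 y s - low1 (y + 1) s <= 2 * y / (y ^ 2 + s) ^ 2.
Proof.
  intros Hy Hs. replace y with ((y - 2) + 2) by ring.
  assert (Hp : 0 <= y - 2) by lra. set (p := y - 2) in *. clearbody p. clear Hy y.
  apply frac_diff_le; try (apply Rmult_lt_0_compat; [lra|apply pow_lt; nra]).
  - apply pow_lt; nra.
  - nonneg_poly.
Qed.

Lemma upp2_step y s : 2 <= y -> 0 <= s ->
  4 * y / (y ^ 2 + s) ^ 3 <= upp2 y s - upp2 (y + 1) s.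
Proof.
  intros Hy Hs. replace y with ((y - 2) + 2) by ring.
  assert (Hp : 0 <= y - 2) by lra. set (p := y - 2) in *. clearbody p. clear Hy y.
  apply Ropp_le_cancel.
  match goal with
  | |- - (_ - _) <= - (?c / ?z) => replace (- (c / z)) with ((- c) / z) by (unfold Rdiv; ring)
  end.
  rewrite Ropp_minus_distr.
  apply frac_diff_le; try (apply Rmult_lt_0_compat; [lra|apply pow_lt; nra]).
  - apply pow_lt; nra.
  - nonneg_poly.
Qed.

(** From the third term on, the two approximations are accurate enough for every
    [s >= 0]. *)
Lemma low1_upp2 s : 0 <= s ->
  4 / (1 + s) ^ 3 + (8 / (4 + s) ^ 3 + upp2 3 s)
  <= (2 / (1 + s) ^ 2 + (4 / (4 + s) ^ 2 + low1 3 s)) ^ 2.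
Proof.
  intros Hs. apply Rminus_le_0. unfold low1, upp2.
  replace (3 * (3 - 1)) with 6 by ring.
  match goal with
  | |- 0 <= (_ + (_ + ?L / _)) ^ 2 - (_ + (_ + ?U / _)) =>
    apply Rle_trans with
      (((60 * ((4 + s) ^ 2 * (s + 6) ^ 5) + 120 * ((1 + s) ^ 2 * (s + 6) ^ 5)
         + L * ((1 + s) ^ 2 * (4 + s) ^ 2)) ^ 2
        - 30 * ((1 + s) * (4 + s) * (s + 6) ^ 4)
          * (120 * ((4 + s) ^ 3 * (s + 6) ^ 6) + 240 * ((1 + s) ^ 3 * (s + 6) ^ 6)
             + U * ((1 + s) ^ 3 * (4 + s) ^ 3)))
       / (900 * ((1 + s) ^ 4 * ((4 + s) ^ 4 * (s + 6) ^ 10))));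
    [|generalize L U; intros; right; field; repeat split; lra]
  end.
  apply Rdiv_le_0_compat.
  - nonneg_poly.
  - repeat apply Rmult_lt_0_compat; try apply pow_lt; lra.
Qed.

Lemma is_lim_seq_inv_bound (a z : nat -> R) :
  is_lim_seq z p_infty -> (forall k, 0 < z k) -> (forall k, Rabs (a k) <= 4 / z k) ->
  is_lim_seq a 0.
Proof.
  intros Hz Hp Ha.
  apply is_lim_seq_abs_0.
  apply (is_lim_seq_le_le (fun _ => 0) _ (fun k => 4 / z k)).
  - intros k. split; [apply Rabs_pos|apply Ha].
  - apply is_lim_seq_const.
  - replace (Finite 0) with (Rbar_mult 4 0) by (simpl; f_equal; ring).
    apply (is_lim_seq_scal_l (fun k => / z k)).
    apply is_lim_seq_inv with (l := p_infty) in Hz; auto. discriminate.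
Qed.

Lemma Rabs_div_le N D z : 0 < D -> 0 < z -> - (4 * D) <= N * z <= 4 * D -> Rabs (N / D) <= 4 / z.
Proof.
  intros HD Hz H. apply Rabs_le. split.
  - apply (Rmult_le_reg_r (D * z)); [now apply Rmult_lt_0_compat|].
    field_simplify; [|lra|lra]. lra.
  - apply (Rmult_le_reg_r (D * z)); [now apply Rmult_lt_0_compat|].
    field_simplify; [|lra|lra]. lra.
Qed.

Lemma low1_bound y s : 3 <= y -> 0 <= s -> Rabs (low1 y s) <= 4 / (s + y).
Proof.
  intros Hy Hs. replace y with ((y - 3) + 3) by ring.
  assert (Hp : 0 <= y - 3) by lra. set (p := y - 3) in *. clearbody p. clear Hy y.
  unfold low1. apply Rabs_div_le.
  - apply Rmult_lt_0_compat; [lra|]. apply pow_lt; nra.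
  - lra.
  - split; apply Rminus_le_0; nonneg_poly.
Qed.

Lemma upp2_bound y s : 3 <= y -> 0 <= s -> Rabs (upp2 y s) <= 4 / (s + y).
Proof.
  intros Hy Hs. replace y with ((y - 3) + 3) by ring.
  assert (Hp : 0 <= y - 3) by lra. set (p := y - 3) in *. clearbody p. clear Hy y.
  unfold upp2. apply Rabs_div_le.
  - apply Rmult_lt_0_compat; [lra|]. apply pow_lt; nra.
  - lra.
  - split; apply Rminus_le_0; nonneg_poly.
Qed.

Lemma mterm_1 u s k : 0 <= u -> 0 <= s ->
  mterm 1 u s k = 2 * pt u k / (pt u k ^ 2 + s) ^ 2.
Proof.
  intros Hu Hs. assert (Hp := pt_ge u k Hu). unfold mterm.
  replace (1 + 1) with (INR 2) by (simpl; ring). rewrite npow_nat by nra. reflexivity.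
Qed.

Lemma mterm_2 u s k : 0 <= u -> 0 <= s ->
  2 * mterm (1 + 1) u s k = 4 * pt u k / (pt u k ^ 2 + s) ^ 3.
Proof.
  intros Hu Hs. assert (Hp := pt_ge u k Hu). unfold mterm.
  replace (1 + 1 + 1) with (INR 3) by (simpl; ring). rewrite npow_nat by nra.
  field. nra.
Qed.

Lemma Sg_1_low s : 0 <= s -> low1 3 s <= Sg 1 2 s.
Proof.
  intros Hs.
  replace (low1 3 s) with (low1 (pt 2 0) s) by (rewrite pt_0; f_equal; ring).
  apply (Series_ge_telescope _ (fun k => low1 (pt 2 k) s)).
  - apply ex_series_mterm; lra.
  - intros k. assert (Hp := pt_ge_first 2 k). rewrite mterm_1, pt_S by lra.
    apply low1_step; lra.
  - assert (H3 : forall k, 3 <= pt 2 k) by (intros k; generalize (pt_ge_first 2 k); lra).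
    apply (is_lim_seq_inv_bound _ (fun k => s + pt 2 k)).
    + eapply is_lim_seq_plus; [apply is_lim_seq_const|apply is_lim_seq_pt|reflexivity].
    + intros k. specialize (H3 k). lra.
    + intros k. now apply low1_bound.
Qed.

Lemma Sg_2_upp s : 0 <= s -> 2 * Sg (1 + 1) 2 s <= upp2 3 s.
Proof.
  intros Hs.
  replace (upp2 3 s) with (upp2 (pt 2 0) s) by (rewrite pt_0; f_equal; ring).
  unfold Sg. rewrite <- Series_scal_l.
  assert (H3 : forall k, 3 <= pt 2 k) by (intros k; generalize (pt_ge_first 2 k); lra).
  apply (Series_le_telescope _ (fun k => upp2 (pt 2 k) s)).
  - intros k. split.
    + generalize (mterm_pos (1 + 1) 2 s k ltac:(lra)). lra.
    + rewrite mterm_2, pt_S by lra. apply upp2_step; auto. specialize (H3 k). lra.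
  - apply (is_lim_seq_inv_bound _ (fun k => s + pt 2 k)).
    + eapply is_lim_seq_plus; [apply is_lim_seq_const|apply is_lim_seq_pt|reflexivity].
    + intros k. specialize (H3 k). lra.
    + intros k. now apply upp2_bound.
Qed.

Lemma Sg_2_le_sqr s : 0 <= s -> 2 * Sg (1 + 1) 0 s <= Sg 1 0 s ^ 2.
Proof.
  intros Hs.
  rewrite (Sg_shift (1 + 1) 0), (Sg_shift (1 + 1) (0 + 1)), (Sg_shift 1 0), (Sg_shift 1 (0 + 1))
    by lra.
  rewrite !Rmult_plus_distr_l, !mterm_1, !mterm_2, !pt_0 by lra.
  replace (0 + 1 + 1) with 2 by ring. replace (1 + (0 + 1)) with 2 by ring.
  assert (H1 := Sg_1_low s Hs). assert (H2 := Sg_2_upp s Hs).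
  assert (H0 := low1_upp2 s Hs).
  apply Rle_trans with (4 / (1 + s) ^ 3 + (8 / (4 + s) ^ 3 + upp2 3 s)).
  - replace (4 * (1 + 0) / ((1 + 0) ^ 2 + s) ^ 3) with (4 / (1 + s) ^ 3) by (field; lra).
    replace (4 * 2 / (2 ^ 2 + s) ^ 3) with (8 / (4 + s) ^ 3) by (field; lra). lra.
  - eapply Rle_trans; [exact H0|]. apply pow_incr.
    replace (2 * (1 + 0) / ((1 + 0) ^ 2 + s) ^ 2) with (2 / (1 + s) ^ 2) by (field; lra).
    replace (2 * 2 / (2 ^ 2 + s) ^ 2) with (4 / (4 + s) ^ 2) by (field; lra).
    split; [|lra].
    assert (0 < 2 / (1 + s) ^ 2) by (apply Rdiv_lt_0_compat; [lra|apply pow_lt; lra]).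
    assert (0 < 4 / (4 + s) ^ 2) by (apply Rdiv_lt_0_compat; [lra|apply pow_lt; lra]).
    assert (0 <= low1 3 s); [|lra].
    unfold low1. replace (3 * (3 - 1)) with 6 by ring.
    apply Rdiv_le_0_compat; [nonneg_poly|].
    apply Rmult_lt_0_compat; [lra|]. apply pow_lt. lra.
Qed.

(** * Euler-Maclaurin summation *)

(** The Taylor polynomial at [x] of [g 0], where [g (S j)] is the derivative of [g j]. *)
Fixpoint taylor (n : nat) (g : nat -> R -> R) (x h : R) : R :=
  match n with
  | O => 0
  | S m => taylor m g x h + g m x / INR (fact m) * h ^ m
  end.

Lemma is_derive_taylor n g x h :
  is_derive (taylor (S n) g x) h (taylor n (fun j => g (S j)) x h).
Proof.
  induction n as [|n IH].
  - simpl. auto_derive; auto.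
  - assert (D : is_derive (fun h => g (S n) x / INR (fact (S n)) * h ^ S n) h
                  (g (S n) x / INR (fact n) * h ^ n)).
    { replace (g (S n) x / INR (fact n) * h ^ n)
        with (g (S n) x / INR (fact (S n)) * (INR (S n) * h ^ n)).
      - apply is_derive_scal. apply is_derive_Reals.
        exact (derivable_pt_lim_pow h (S n)).
      - rewrite fact_simpl, mult_INR.
        assert (INR (fact n) <> 0) by apply INR_fact_neq_0.
        assert (INR (S n) <> 0) by (now apply not_0_INR).
        field. split; auto. }
    exact (is_derive_plus _ _ _ _ _ IH D).
Qed.

Lemma taylor_at_0 n g x : taylor (S n) g x 0 = g 0%nat x.
Proof.
  induction n as [|n IH].
  - simpl. field.
  - change (taylor (S (S n)) g x 0)
      with (taylor (S n) g x 0 + g (S n) x / INR (fact (S n)) * 0 ^ S n).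
    rewrite IH. simpl pow. ring.
Qed.

Lemma abs_mean_value phi phi' h K :
  phi 0 = 0 -> (forall t, Rabs t <= Rabs h -> is_derive phi t (phi' t)) ->
  (forall t, Rabs t <= Rabs h -> Rabs (phi' t) <= K) -> Rabs (phi h) <= K * Rabs h.
Proof.
  intros H0 HD HK.
  assert (Ab : forall c, (h <= c <= 0 \/ 0 <= c <= h) -> Rabs c <= Rabs h).
  { intros c [Hc|Hc]; [rewrite !Rabs_left1; lra|rewrite !Rabs_pos_eq; lra]. }
  destruct (Rtotal_order h 0) as [H|[H|H]].
  - destruct (mean_value phi phi' h 0 H) as [c [Hc Hch]]; auto.
    rewrite H0 in Hc. replace (phi h) with (phi' c * h) by lra.
    rewrite Rabs_mult. apply Rmult_le_compat_r; [apply Rabs_pos|]. apply HK, Ab. lra.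
  - subst. rewrite H0, Rabs_R0. lra.
  - destruct (mean_value phi phi' 0 h H) as [c [Hc Hch]]; auto.
    rewrite H0 in Hc. replace (phi h) with (phi' c * h) by lra.
    rewrite Rabs_mult. apply Rmult_le_compat_r; [apply Rabs_pos|]. apply HK, Ab. lra.
Qed.

(** The factor [1 / n!] of the sharp remainder is dropped, which lets the induction differentiate
    once and bound the increment by the mean value theorem. *)
Lemma taylor_bound n : forall (g : nat -> R -> R) x h B,
  (forall j c, (j < n)%nat -> is_derive (g j) c (g (S j) c)) ->
  (forall c, Rabs (c - x) <= Rabs h -> Rabs (g n c) <= B) ->
  Rabs (g 0%nat (x + h) - taylor n g x h) <= B * Rabs h ^ n.
Proof.
  induction n as [|n IH]; intros g x h B HD HB.
  - simpl. rewrite Rminus_0_r, Rmult_1_r. apply HB. right. f_equal. ring.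
  - assert (HB0 : 0 <= B).
    { eapply Rle_trans; [apply Rabs_pos|]. apply (HB x).
      replace (x - x) with 0 by ring. rewrite Rabs_R0. apply Rabs_pos. }
    simpl pow. replace (B * (Rabs h * Rabs h ^ n)) with (B * Rabs h ^ n * Rabs h) by ring.
    apply (abs_mean_value (fun t => g 0%nat (x + t) - taylor (S n) g x t)
             (fun t => g 1%nat (x + t) - taylor n (fun j => g (S j)) x t)).
    + rewrite taylor_at_0, Rplus_0_r. ring.
    + intros t _.
      assert (D : is_derive (fun t => g 0%nat (x + t)) t (1 * g 1%nat (x + t))).
      { apply (is_derive_comp (g 0%nat) (fun t => x + t)); [apply HD; lia|].
        auto_derive; auto. }
      rewrite Rmult_1_l in D.
      exact (is_derive_minus _ _ _ _ _ D (is_derive_taylor n g x t)).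
    + intros t Ht. eapply Rle_trans.
      * apply (IH (fun j => g (S j)) x t B).
        -- intros j c Hj. apply HD. lia.
        -- intros c Hc. apply HB. lra.
      * apply Rmult_le_compat_l; auto. apply pow_incr. split; [apply Rabs_pos|auto].
Qed.

(** When [g 0] is an antiderivative of [- f], the increments of [em g] over unit intervals
    reproduce the values of [f] at the midpoints up to an error controlled by [g 6]: [1],
    [- 1 / 24] and [7 / 5760] are the first coefficients of [(h / 2) / sinh (h / 2)]. *)
Definition em (g : nat -> R -> R) (x : R) : R :=
  g 0%nat x - g 2%nat x / 24 + 7 / 5760 * g 4%nat x.

Lemma em_step (g : nat -> R -> R) y B :
  (forall j c, (j < 6)%nat -> is_derive (g j) c (g (S j) c)) ->
  (forall c, Rabs (c - y) <= 1 / 2 -> Rabs (g 6%nat c) <= B) ->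
  Rabs (em g (y - 1 / 2) - em g (y + 1 / 2) + g 1%nat y) <= B.
Proof.
  intros HD HB.
  assert (HB0 : 0 <= B).
  { eapply Rle_trans; [apply Rabs_pos|]. apply (HB y).
    rewrite Rminus_diag, Rabs_R0. lra. }
  assert (A1 : Rabs (1 / 2) = 1 / 2) by (apply Rabs_pos_eq; lra).
  assert (A2 : Rabs (- (1 / 2)) = 1 / 2) by (rewrite Rabs_Ropp; exact A1).
  assert (P0 : forall h, Rabs h = 1 / 2 ->
    Rabs (g 0%nat (y + h) - taylor 6 g y h) <= B * Rabs h ^ 6).
  { intros h Hh. apply taylor_bound; auto. rewrite Hh. auto. }
  assert (P2 : forall h, Rabs h = 1 / 2 ->
    Rabs (g 2%nat (y + h) - taylor 4 (fun j => g (S (S j))) y h) <= B * Rabs h ^ 4).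
  { intros h Hh. apply (taylor_bound 4 (fun j => g (S (S j)))).
    - intros j c Hj. apply HD. lia.
    - rewrite Hh. auto. }
  assert (P4 : forall h, Rabs h = 1 / 2 ->
    Rabs (g 4%nat (y + h) - taylor 2 (fun j => g (S (S (S (S j))))) y h) <= B * Rabs h ^ 2).
  { intros h Hh. apply (taylor_bound 2 (fun j => g (S (S (S (S j)))))).
    - intros j c Hj. apply HD. lia.
    - rewrite Hh. auto. }
  assert (Q0 := P0 _ A1). assert (Q0' := P0 _ A2).
  assert (Q2 := P2 _ A1). assert (Q2' := P2 _ A2).
  assert (Q4 := P4 _ A1). assert (Q4' := P4 _ A2).
  clear P0 P2 P4 HD HB. rewrite A1 in Q0, Q2, Q4. rewrite A2 in Q0', Q2', Q4'.
  unfold em. cbn [taylor] in Q0, Q0', Q2, Q2', Q4, Q4'.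
  replace (INR (fact 0)) with 1 in * by reflexivity.
  replace (INR (fact 1)) with 1 in * by reflexivity.
  replace (INR (fact 2)) with 2 in * by (simpl; ring).
  replace (INR (fact 3)) with 6 in * by (simpl; ring).
  replace (INR (fact 4)) with 24 in * by (simpl; ring).
  replace (INR (fact 5)) with 120 in * by (simpl; ring).
  apply Rabs_le_between in Q0, Q0', Q2, Q2', Q4, Q4'.
  change (y - 1 / 2) with (y + - (1 / 2)) in *.
  apply Rabs_le_between.
  split; lra.
Qed.

Definition mono (s : R) (j : nat) (q x : R) : R := x ^ j * npow q (x ^ 2 + s).

Lemma is_derive_mono s j q x : 0 < s ->
  is_derive (mono s j q) x
    (INR j * mono s (Init.Nat.pred j) q x - 2 * q * mono s (S j) (q + 1) x).
Proof.
  intros Hs. assert (Hz : 0 < x ^ 2 + s) by nra.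
  assert (D1 : is_derive (fun x => x ^ j) x (INR j * x ^ Init.Nat.pred j)).
  { apply is_derive_Reals. apply derivable_pt_lim_pow. }
  assert (D2 : is_derive (fun x => npow q (x ^ 2 + s)) x
                 (2 * x * (- q * npow (q + 1) (x ^ 2 + s)))).
  { apply (is_derive_comp (npow q) (fun x => x ^ 2 + s)).
    - now apply is_derive_npow.
    - auto_derive; auto. ring. }
  evar_last; [exact (is_derive_mult _ _ _ _ _ D1 D2 Rmult_comm)|].
  unfold plus, mult, mono; simpl. ring.
Qed.

(** The successive derivatives of [npow mu (x ^ 2 + s) / mu]; the summand is the
    opposite of the first one. *)
Definition chain (mu s : R) (j : nat) (x : R) : R :=
  let p := mu + 1 in
  let M j i := mono s j (mu + i) x in
  match j with
  | 0%nat => / mu * M 0%nat 0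
  | 1%nat => - 2 * M 1%nat 1
  | 2%nat => - 2 * M 0%nat 1 + 4 * p * M 2%nat 2
  | 3%nat => 12 * p * M 1%nat 2 - 8 * p * (p + 1) * M 3%nat 3
  | 4%nat => 12 * p * M 0%nat 2 - 48 * p * (p + 1) * M 2%nat 3
             + 16 * p * (p + 1) * (p + 2) * M 4%nat 4
  | 5%nat => - 120 * p * (p + 1) * M 1%nat 3 + 160 * p * (p + 1) * (p + 2) * M 3%nat 4
             - 32 * p * (p + 1) * (p + 2) * (p + 3) * M 5%nat 5
  | _ => - 120 * p * (p + 1) * M 0%nat 3 + 720 * p * (p + 1) * (p + 2) * M 2%nat 4
         - 480 * p * (p + 1) * (p + 2) * (p + 3) * M 4%nat 5
         + 64 * p * (p + 1) * (p + 2) * (p + 3) * (p + 4) * M 6%nat 6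
  end.


(** The exponent [i + 1] is kept apart from [mu] so that the chain below can be checked
    by normalizing numerals. *)
Lemma is_derive_mono_scal s mu c j i x : 0 < s ->
  is_derive (fun x => c * mono s j (mu + i) x) x
    (c * (INR j * mono s (Init.Nat.pred j) (mu + i) x
          - 2 * (mu + i) * mono s (S j) (mu + (i + 1)) x)).
Proof.
  intros Hs. apply is_derive_scal. rewrite <- Rplus_assoc. now apply is_derive_mono.
Qed.

Ltac norm_chain :=
  replace (0 + 1) with 1 by ring; replace (1 + 1) with 2 by ring;
  replace (2 + 1) with 3 by ring; replace (3 + 1) with 4 by ring;
  replace (4 + 1) with 5 by ring; replace (5 + 1) with 6 by ring;
  simpl; field; lra.

Lemma is_derive_chain mu s j x : 0 < mu -> 0 < s -> (j < 6)%nat ->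
  is_derive (chain mu s j) x (chain mu s (S j) x).
Proof.
  intros Hmu Hs Hj.
  assert (D := fun c j i => is_derive_mono_scal s mu c j i x Hs).
  assert (E : forall (f : R -> R) (l l' : R), is_derive f x l -> l = l' -> is_derive f x l')
    by (intros f l l' H <-; exact H).
  assert (Dp : forall (f g : R -> R) (df dg : R), is_derive f x df -> is_derive g x dg ->
    is_derive (fun x => f x + g x) x (df + dg))
    by (intros f g df dg H1 H2; exact (is_derive_plus f g x df dg H1 H2)).
  assert (Dm : forall (f g : R -> R) (df dg : R), is_derive f x df -> is_derive g x dg ->
    is_derive (fun x => f x - g x) x (df - dg))
    by (intros f g df dg H1 H2; exact (is_derive_minus f g x df dg H1 H2)).
  do 6 (try (destruct j as [|j])); try lia; clear Hj; unfold chain; cbn beta iota zeta.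
  - eapply E; [exact (D _ _ _)|norm_chain].
  - eapply E; [exact (D _ _ _)|norm_chain].
  - eapply E; [exact (Dp _ _ _ _ (D _ _ _) (D _ _ _))|norm_chain].
  - eapply E; [exact (Dm _ _ _ _ (D _ _ _) (D _ _ _))|norm_chain].
  - eapply E; [exact (Dp _ _ _ _ (Dm _ _ _ _ (D _ _ _) (D _ _ _)) (D _ _ _))|norm_chain].
  - eapply E; [exact (Dm _ _ _ _ (Dp _ _ _ _ (D _ _ _) (D _ _ _)) (D _ _ _))|norm_chain].
Qed.

(** Each factor [x ^ 2] is absorbed by one unit of the exponent. *)
Lemma mono_bound s i q q' x : 0 < s -> q' = q + INR i ->
  0 <= mono s (2 * i) q' x <= npow q (x ^ 2 + s).
Proof.
  intros Hs ->. assert (Hz : 0 < x ^ 2 + s) by nra.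
  unfold mono. rewrite npow_plus, npow_nat, pow_mult by auto.
  assert (Hn := npow_pos q (x ^ 2 + s)).
  replace ((x ^ 2) ^ i * (npow q (x ^ 2 + s) * / (x ^ 2 + s) ^ i))
    with (npow q (x ^ 2 + s) * (x ^ 2 / (x ^ 2 + s)) ^ i).
  2: { unfold Rdiv. rewrite Rpow_mult_distr, pow_inv. ring. }
  assert (Hr : 0 <= x ^ 2 / (x ^ 2 + s) <= 1).
  { split; [apply Rdiv_le_0_compat; nra|]. apply Rle_div_l; nra. }
  assert (Hi : 0 <= (x ^ 2 / (x ^ 2 + s)) ^ i <= 1).
  { split; [now apply pow_le|]. rewrite <- (pow1 i). now apply pow_incr. }
  split; [apply Rmult_le_pos; lra|]. rewrite <- (Rmult_1_r (npow q (x ^ 2 + s))) at 2.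
  apply Rmult_le_compat_l; lra.
Qed.

(** The sum of the absolute values of the coefficients of [chain mu s 6]. *)
Definition chain6_bound (mu : R) : R :=
  let p := mu + 1 in
  120 * p * (p + 1) + 720 * p * (p + 1) * (p + 2)
  + 480 * p * (p + 1) * (p + 2) * (p + 3) + 64 * p * (p + 1) * (p + 2) * (p + 3) * (p + 4).

Lemma chain6_bound_nonneg mu : 0 < mu -> 0 <= chain6_bound mu.
Proof.
  intros Hmu. unfold chain6_bound.
  repeat apply Rplus_le_le_0_compat; repeat apply Rmult_le_pos; lra.
Qed.

Lemma abs_lin_le c m n : 0 <= c -> 0 <= m <= n -> - (c * n) <= c * m <= c * n.
Proof. intros Hc Hm. split; nra. Qed.

Lemma chain6_le mu s x : 0 < mu -> 0 < s ->
  Rabs (chain mu s 6 x) <= chain6_bound mu * npow (mu + 3) (x ^ 2 + s).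
Proof.
  intros Hmu Hs. unfold chain, chain6_bound. cbv zeta.
  set (n := npow (mu + 3) (x ^ 2 + s)).
  assert (B0 : 0 <= mono s 0 (mu + 3) x <= n) by (apply (mono_bound s 0); auto; simpl; ring).
  assert (B1 : 0 <= mono s 2 (mu + 4) x <= n) by (apply (mono_bound s 1); auto; simpl; ring).
  assert (B2 : 0 <= mono s 4 (mu + 5) x <= n) by (apply (mono_bound s 2); auto; simpl; ring).
  assert (B3 : 0 <= mono s 6 (mu + 6) x <= n) by (apply (mono_bound s 3); auto; simpl; ring).
  set (p := mu + 1). assert (Hp : 0 <= p) by (unfold p; lra).
  clearbody n p.
  assert (C0 : 0 <= 120 * p * (p + 1)) by (repeat apply Rmult_le_pos; lra).
  assert (C1 : 0 <= 720 * p * (p + 1) * (p + 2)) by (repeat apply Rmult_le_pos; lra).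
  assert (C2 : 0 <= 480 * p * (p + 1) * (p + 2) * (p + 3)) by (repeat apply Rmult_le_pos; lra).
  assert (C3 : 0 <= 64 * p * (p + 1) * (p + 2) * (p + 3) * (p + 4))
    by (repeat apply Rmult_le_pos; lra).
  apply (abs_lin_le _ _ _ C0) in B0. apply (abs_lin_le _ _ _ C1) in B1.
  apply (abs_lin_le _ _ _ C2) in B2. apply (abs_lin_le _ _ _ C3) in B3.
  apply Rabs_le_between. rewrite !Rmult_plus_distr_r. lra.
Qed.

(** Each step of the Euler-Maclaurin formula costs at most a term of this telescoping
    sum, where [s = t ^ 2]. *)
Lemma inv_square_telescope y t :
  1 <= y -> 1 <= t ->
  / ((y - 1 / 2) ^ 2 + t ^ 2) <= 2 / (y - 1 + t) - 2 / (y + t).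
Proof.
  intros Hy Ht.
  replace (2 / (y - 1 + t) - 2 / (y + t)) with (/ (((y - 1 + t) * (y + t)) / 2))
    by (field; lra).
  apply Rinv_le_contravar.
  - apply Rdiv_lt_0_compat; [|lra]. apply Rmult_lt_0_compat; lra.
  - generalize (Rle_0_sqr (y - 1 / 2 - t)). unfold Rsqr. nra.
Qed.

Lemma em_chain_step mu t y : 0 < mu -> 1 <= t -> 1 <= y ->
  Rabs (em (chain mu (t ^ 2)) (y - 1 / 2) - em (chain mu (t ^ 2)) (y + 1 / 2)
        - 2 * y * npow (mu + 1) (y ^ 2 + t ^ 2))
  <= chain6_bound mu * npow (mu + 2) (t ^ 2) * (2 / (y - 1 + t) - 2 / (y + t)).
Proof.
  intros Hmu Ht Hy. assert (Hs : 0 < t ^ 2) by nra.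
  assert (HC := chain6_bound_nonneg mu Hmu).
  assert (E := em_step (chain mu (t ^ 2)) y
    (chain6_bound mu * npow (mu + 3) ((y - 1 / 2) ^ 2 + t ^ 2))).
  unfold Rminus at 1.
  replace (- (2 * y * npow (mu + 1) (y ^ 2 + t ^ 2))) with (chain mu (t ^ 2) 1 y)
    by (unfold chain, mono; ring).
  eapply Rle_trans; [apply E|].
  - intros j c Hj. now apply is_derive_chain.
  - intros c Hc. eapply Rle_trans; [now apply chain6_le|].
    apply Rmult_le_compat_l; auto. apply npow_le; [lra|].
    apply Rabs_le_between in Hc. split; nra.
  - rewrite Rmult_assoc. apply Rmult_le_compat_l; auto.
    assert (Hz : t ^ 2 <= (y - 1 / 2) ^ 2 + t ^ 2) by nra.
    replace (mu + 3) with (mu + 2 + 1) by ring. rewrite npow_succ by lra.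
    apply Rmult_le_compat.
    + left; apply npow_pos.
    + left; apply Rinv_0_lt_compat; lra.
    + apply npow_le; lra.
    + now apply inv_square_telescope.
Qed.

Lemma em_chain_bound mu s x : 0 < mu -> 1 <= s ->
  Rabs (em (chain mu s) x)
  <= (/ mu + 10 * (mu + 3) ^ 3) * npow mu (x ^ 2 + s).
Proof.
  intros Hmu Hs. assert (Hz : 1 <= x ^ 2 + s) by nra.
  assert (Hle : forall i, 0 <= i -> npow (mu + i) (x ^ 2 + s) <= npow mu (x ^ 2 + s)).
  { intros i Hi. unfold npow. apply Rle_Rpower; lra. }
  unfold em, chain. cbv zeta. set (n := npow mu (x ^ 2 + s)).
  assert (M0 : 0 <= mono s 0 (mu + 0) x <= n).
  { apply (mono_bound s 0); simpl; lra. }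
  assert (M1 : forall i q, 0 <= i -> q = mu + i + INR 0 -> 0 <= mono s 0 q x <= n).
  { intros i q Hi Hq. destruct (mono_bound s 0 _ _ x ltac:(lra) Hq) as [H1 H2].
    split; auto. eapply Rle_trans; [exact H2|]. now apply Hle. }
  assert (M2 : forall i q, 0 <= i -> q = mu + i + INR 1 -> 0 <= mono s 2 q x <= n).
  { intros i q Hi Hq. destruct (mono_bound s 1 _ _ x ltac:(lra) Hq) as [H1 H2].
    split; auto. eapply Rle_trans; [exact H2|]. now apply Hle. }
  assert (M4 : forall i q, 0 <= i -> q = mu + i + INR 2 -> 0 <= mono s 4 q x <= n).
  { intros i q Hi Hq. destruct (mono_bound s 2 _ _ x ltac:(lra) Hq) as [H1 H2].
    split; auto. eapply Rle_trans; [exact H2|]. now apply Hle. }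
  assert (A1 := M1 1 (mu + 1) ltac:(lra) ltac:(simpl; ring)).
  assert (A2 := M2 1 (mu + 2) ltac:(lra) ltac:(simpl; ring)).
  assert (A3 := M1 2 (mu + 2) ltac:(lra) ltac:(simpl; ring)).
  assert (A4 := M2 2 (mu + 3) ltac:(lra) ltac:(simpl; ring)).
  assert (A5 := M4 2 (mu + 4) ltac:(lra) ltac:(simpl; ring)).
  clear M1 M2 M4 Hle.
  assert (Hn : 0 <= n) by lra.
  assert (Hi : 0 <= / mu) by (left; now apply Rinv_0_lt_compat).
  apply (abs_lin_le (/ mu) _ _ Hi) in M0.
  assert (C1 : 0 <= 2) by lra. apply (abs_lin_le _ _ _ C1) in A1.
  assert (C2 : 0 <= 4 * (mu + 1)) by lra. apply (abs_lin_le _ _ _ C2) in A2.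
  assert (C3 : 0 <= 12 * (mu + 1)) by lra. apply (abs_lin_le _ _ _ C3) in A3.
  assert (C4 : 0 <= 48 * (mu + 1) * (mu + 1 + 1)) by nra. apply (abs_lin_le _ _ _ C4) in A4.
  assert (C5 : 0 <= 16 * (mu + 1) * (mu + 1 + 1) * (mu + 1 + 2))
    by (repeat apply Rmult_le_pos; lra).
  apply (abs_lin_le _ _ _ C5) in A5.
  assert (K : (2 + 4 * (mu + 1)) / 24
     + 7 / 5760 * (12 * (mu + 1) + 48 * (mu + 1) * (mu + 1 + 1)
                   + 16 * (mu + 1) * (mu + 1 + 1) * (mu + 1 + 2)) <= 10 * (mu + 3) ^ 3).
  { apply Rminus_le_0. field_simplify.
    apply Rdiv_le_0_compat; [|lra].
    repeat apply Rplus_le_le_0_compat; try apply Rmult_le_pos; try apply pow_le; lra. }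
  apply (Rmult_le_compat_r n _ _ Hn) in K.
  apply Rabs_le_between. lra.
Qed.

Lemma em_chain_lim mu t u : 0 < mu -> 1 <= t -> 0 <= u ->
  is_lim_seq (fun k => em (chain mu (t ^ 2)) (pt u k - 1 / 2)) 0.
Proof.
  intros Hmu Ht Hu. apply is_lim_seq_abs_0.
  apply (is_lim_seq_le_le (fun _ => 0) _
    (fun k => (/ mu + 10 * (mu + 3) ^ 3) * npow mu ((pt u k - 1 / 2) ^ 2 + t ^ 2))).
  - intros k. split; [apply Rabs_pos|]. apply em_chain_bound; nra.
  - apply is_lim_seq_const.
  - replace (Finite 0) with (Rbar_mult (/ mu + 10 * (mu + 3) ^ 3) 0)
      by (simpl; f_equal; ring).
    apply is_lim_seq_scal_l. apply is_lim_seq_npow; auto.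
    apply (is_lim_seq_le_p_loc (pt u)); [|apply is_lim_seq_pt].
    exists 0%nat. intros k _. generalize (pt_ge u k Hu). nra.
Qed.

(** Both the main terms and the errors of the Euler-Maclaurin steps telescope. The remainder
    has order [s ^ (- mu - 5 / 2)], beyond the terms in [s ^ (- mu - 2)] that matter later. *)
Lemma Sg_em mu u t : 0 < mu -> 0 <= u -> 1 <= t ->
  Rabs (Sg mu u (t ^ 2) - em (chain mu (t ^ 2)) (u + 1 / 2))
  <= 2 * chain6_bound mu * (npow (mu + 2) (t ^ 2) / t).
Proof.
  intros Hmu Hu Ht.
  set (W := fun k => chain6_bound mu * npow (mu + 2) (t ^ 2) * (2 / (pt u k - 1 + t))).
  set (T := fun k => em (chain mu (t ^ 2)) (pt u k - 1 / 2)).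
  assert (HC := chain6_bound_nonneg mu Hmu).
  assert (HT := em_chain_lim mu t u Hmu Ht Hu). fold T in HT.
  assert (HW : is_lim_seq W 0).
  { unfold W. replace (Finite 0) with
      (Rbar_mult (chain6_bound mu * npow (mu + 2) (t ^ 2)) 0) by (simpl; f_equal; ring).
    apply is_lim_seq_scal_l.
    replace (Finite 0) with (Rbar_mult 2 0) by (simpl; f_equal; ring).
    apply (is_lim_seq_scal_l (fun k => / (pt u k - 1 + t))).
    evar_last.
    - apply (is_lim_seq_inv _ p_infty); [|discriminate].
      apply (is_lim_seq_plus _ _ p_infty t); [|apply is_lim_seq_const|reflexivity].
      apply (is_lim_seq_minus _ _ p_infty 1);
        [apply is_lim_seq_pt|apply is_lim_seq_const|reflexivity].
    - reflexivity. }
  assert (Hstep : forall k, Rabs (T k - T (S k) - mterm mu u (t ^ 2) k) <= W k - W (S k)).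
  { intros k. assert (Hp := pt_ge u k Hu).
    assert (E := em_chain_step mu t (pt u k) Hmu Ht Hp).
    unfold T, W, mterm. rewrite pt_S.
    replace (pt u k + 1 - 1 / 2) with (pt u k + 1 / 2) by field.
    replace (pt u k + 1 - 1 + t) with (pt u k + t) by ring. lra. }
  assert (Hm : forall k, 0 <= mterm mu u (t ^ 2) k) by (intros k; left; now apply mterm_pos).
  assert (Hup : Sg mu u (t ^ 2) <= T 0%nat + W 0%nat).
  { apply (Series_le_telescope _ (fun k => T k + W k)).
    - intros k. split; auto. specialize (Hstep k). apply Rabs_le_between in Hstep. lra.
    - replace (Finite 0) with (Finite (0 + 0)) by (f_equal; ring).
      now apply is_lim_seq_plus'. }
  assert (Hlo : T 0%nat - W 0%nat <= Sg mu u (t ^ 2)).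
  { apply (Series_ge_telescope _ (fun k => T k - W k)).
    - apply ex_series_mterm; auto. nra.
    - intros k. specialize (Hstep k). apply Rabs_le_between in Hstep. lra.
    - replace (Finite 0) with (Finite (0 - 0)) by (f_equal; ring).
      now apply is_lim_seq_minus'. }
  assert (HW0 : W 0%nat <= 2 * chain6_bound mu * (npow (mu + 2) (t ^ 2) / t)).
  { unfold W. rewrite pt_0.
    assert (Hn := npow_pos (mu + 2) (t ^ 2)).
    assert (2 / (1 + u - 1 + t) <= 2 / t).
    { apply Rmult_le_compat_l; [lra|]. apply Rinv_le_contravar; lra. }
    apply Rle_trans with (chain6_bound mu * npow (mu + 2) (t ^ 2) * (2 / t)).
    - apply Rmult_le_compat_l; auto. apply Rmult_le_pos; lra.
    - right. field. lra. }
  unfold T in Hup, Hlo. rewrite pt_0 in Hup, Hlo.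
  replace (1 + u - 1 / 2) with (u + 1 / 2) in Hup, Hlo by field.
  apply Rabs_le_between. lra.
Qed.

(** * Asymptotic expansions *)

Definition bigO (n : nat) (r : R -> R) : Prop :=
  exists K T, 0 <= K /\ 1 <= T /\ forall t, T <= t -> Rabs (r t) <= K / t ^ n.

Lemma bigO_ext n r r' : (forall t, 1 <= t -> r t = r' t) -> bigO n r -> bigO n r'.
Proof.
  intros E (K & T & HK & HT & H). exists K, T. repeat split; auto.
  intros t Ht. rewrite <- E by lra. now apply H.
Qed.

Lemma bigO_plus n r r' : bigO n r -> bigO n r' -> bigO n (fun t => r t + r' t).
Proof.
  intros (K & T & HK & HT & H) (K' & T' & HK' & HT' & H').
  exists (K + K'), (Rmax T T'). repeat split; [lra| |].
  - eapply Rle_trans; [exact HT|apply Rmax_l].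
  - intros t Ht. generalize (Rmax_l T T') (Rmax_r T T'). intros.
    eapply Rle_trans; [apply Rabs_triang|].
    unfold Rdiv. rewrite Rmult_plus_distr_r.
    apply Rplus_le_compat; [apply H|apply H']; lra.
Qed.

Lemma bigO_mult n m r r' : bigO n r -> bigO m r' -> bigO (n + m) (fun t => r t * r' t).
Proof.
  intros (K & T & HK & HT & H) (K' & T' & HK' & HT' & H').
  exists (K * K'), (Rmax T T'). repeat split; [now apply Rmult_le_pos| |].
  - eapply Rle_trans; [exact HT|apply Rmax_l].
  - intros t Ht. generalize (Rmax_l T T') (Rmax_r T T'). intros.
    rewrite Rabs_mult, pow_add.
    replace (K * K' / (t ^ n * t ^ m)) with (K / t ^ n * (K' / t ^ m)).
    + apply Rmult_le_compat; try apply Rabs_pos; [apply H|apply H']; lra.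
    + field. split; apply pow_nonzero; lra.
Qed.

Lemma bigO_const c : bigO 0 (fun _ => c).
Proof.
  exists (Rabs c), 1. repeat split; [apply Rabs_pos|lra|].
  intros t Ht. simpl. lra.
Qed.

Lemma bigO_scal n c r : bigO n r -> bigO n (fun t => c * r t).
Proof. intros H. exact (bigO_mult 0 n _ _ (bigO_const c) H). Qed.

Lemma bigO_weaken n m r : (m <= n)%nat -> bigO n r -> bigO m r.
Proof.
  intros Hm (K & T & HK & HT & H). exists K, T. repeat split; auto.
  intros t Ht. eapply Rle_trans; [now apply H|].
  apply Rmult_le_compat_l; auto.
  apply Rinv_le_contravar; [apply pow_lt; lra|]. apply Rle_pow; auto. lra.
Qed.

Lemma bigO_minus n r r' : bigO n r -> bigO n r' -> bigO n (fun t => r t - r' t).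
Proof.
  intros H H'. apply (bigO_ext n (fun t => r t + (-1) * r' t)).
  - intros. ring.
  - apply bigO_plus; auto. now apply bigO_scal.
Qed.

Lemma bigO_small n r eps : 0 < eps -> bigO (S n) r ->
  exists T, 1 <= T /\ forall t, T <= t -> Rabs (r t) <= eps.
Proof.
  intros He H. apply (bigO_weaken _ 1) in H; [|lia].
  destruct H as (K & T & HK & HT & H).
  exists (Rmax T (K / eps)). split.
  - eapply Rle_trans; [exact HT|apply Rmax_l].
  - intros t Ht. generalize (Rmax_l T (K / eps)) (Rmax_r T (K / eps)). intros.
    eapply Rle_trans; [apply H; lra|]. rewrite pow_1.
    apply Rle_div_l; [lra|]. assert (K / eps <= t) by lra.
    apply (Rmult_le_compat_r eps) in H2; [|lra].
    unfold Rdiv in H2. rewrite Rmult_assoc, Rinv_l in H2; lra.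
Qed.

Lemma bigO_compose (phi : R -> R) n m r : (0 < n)%nat ->
  (exists K, 0 <= K /\ forall y, Rabs y <= 1 / 2 -> Rabs (phi y) <= K * Rabs y ^ m) ->
  bigO n r -> bigO (n * m) (fun t => phi (r t)).
Proof.
  intros Hn (C & HC & Hphi) Hr.
  destruct n as [|n]; [lia|].
  destruct (bigO_small n r (1 / 2) ltac:(lra) Hr) as (T' & HT' & H').
  destruct Hr as (K & T & HK & HT & H).
  exists (C * K ^ m), (Rmax T T'). repeat split.
  - apply Rmult_le_pos; auto. now apply pow_le.
  - eapply Rle_trans; [exact HT|apply Rmax_l].
  - intros t Ht. generalize (Rmax_l T T') (Rmax_r T T'). intros.
    eapply Rle_trans; [apply Hphi, H'; lra|].
    unfold Rdiv. rewrite Rmult_assoc. apply Rmult_le_compat_l; auto.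
    rewrite pow_mult, <- pow_inv, <- Rpow_mult_distr.
    apply pow_incr. split; [apply Rabs_pos|]. apply H; lra.
Qed.

Lemma ln_taylor y : Rabs y <= 1 / 2 -> Rabs (ln (1 + y) - y + y ^ 2 / 2) <= 2 * Rabs y ^ 3.
Proof.
  intros Hy. replace (2 * Rabs y ^ 3) with (2 * Rabs y ^ 2 * Rabs y) by ring.
  apply (abs_mean_value (fun y => ln (1 + y) - y + y ^ 2 / 2) (fun y => y ^ 2 / (1 + y))).
  - rewrite Rplus_0_r, ln_1. field.
  - intros t Ht. assert (Hb : - (1 / 2) <= t <= 1 / 2) by (apply Rabs_le_between; lra).
    auto_derive; [lra|]. field. lra.
  - intros t Ht. assert (Hb : - (1 / 2) <= t <= 1 / 2) by (apply Rabs_le_between; lra).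
    rewrite Rabs_pos_eq by (apply Rdiv_le_0_compat; nra).
    apply Rle_div_l; [lra|].
    rewrite !pow2_abs.
    assert (t ^ 2 <= y ^ 2).
    { rewrite <- (pow2_abs t), <- (pow2_abs y). apply pow_incr. split; [apply Rabs_pos|auto]. }
    nra.
Qed.

Lemma exp_taylor_1 y : Rabs y <= 1 / 2 -> Rabs (exp y - 1) <= 3 * Rabs y.
Proof.
  intros Hy.
  apply (abs_mean_value (fun y => exp y - 1) exp).
  - rewrite exp_0. ring.
  - intros t Ht. auto_derive; auto. ring.
  - intros t Ht. assert (Hb : - (1 / 2) <= t <= 1 / 2) by (apply Rabs_le_between; lra).
    rewrite Rabs_pos_eq by (left; apply exp_pos).
    apply Rle_trans with (exp 1); [|apply exp_le_3].
    left. apply exp_increasing. lra.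
Qed.

Lemma exp_taylor y : Rabs y <= 1 / 2 -> Rabs (exp y - 1 - y) <= 3 * Rabs y ^ 2.
Proof.
  intros Hy. replace (3 * Rabs y ^ 2) with (3 * Rabs y * Rabs y) by ring.
  apply (abs_mean_value (fun y => exp y - 1 - y) (fun y => exp y - 1)).
  - rewrite exp_0. ring.
  - intros t Ht. auto_derive; auto. ring.
  - intros t Ht. eapply Rle_trans; [apply exp_taylor_1; lra|]. lra.
Qed.

Section Expansion.

Variables (mu u : R).
Hypothesis (Hmu : 0 < mu) (Hu : 0 <= u).

Let x := u + 1 / 2.
Let z (t : R) : R := t ^ 2 + x ^ 2.

Lemma z_pos t : 1 <= t -> 0 < z t.
Proof. intros Ht. unfold z. nra. Qed.

Lemma z_le t : 1 <= t -> z t <= (1 + x ^ 2) * t ^ 2.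
Proof.
  intros Ht. unfold z.
  assert (0 <= (t ^ 2 - 1) * x ^ 2) by (apply Rmult_le_pos; [nra|apply pow2_ge_0]). lra.
Qed.

Lemma bigO_inv_z : bigO 2 (fun t => / z t).
Proof.
  exists 1, 1. repeat split; try lra. intros t Ht.
  assert (Hz := z_pos t Ht).
  rewrite Rabs_pos_eq by (left; now apply Rinv_0_lt_compat).
  unfold Rdiv. rewrite Rmult_1_l. apply Rinv_le_contravar; [nra|]. unfold z. nra.
Qed.

Lemma bigO_inv_z_pow n : bigO (2 * n) (fun t => / z t ^ n).
Proof.
  induction n as [|n IH].
  - apply (bigO_ext _ (fun _ => 1)); [intros; simpl; field|]. apply bigO_const.
  - replace (2 * S n)%nat with (2 + 2 * n)%nat by lia.
    apply (bigO_ext _ (fun t => / z t * / z t ^ n)).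
    + intros t Ht. simpl. assert (Hz := z_pos t Ht). field. split; [apply pow_nonzero|]; lra.
    + apply bigO_mult; auto. apply bigO_inv_z.
Qed.

Definition coef2 : R := 7 / 480 - x ^ 2 / 6.

Let Er (t : R) : R := mu * Sg mu u (t ^ 2) * Rpower (z t) mu.

Lemma npow_Rpower i t : npow (mu + i) t * Rpower t mu = npow i t.
Proof. unfold npow. rewrite <- Rpower_plus. f_equal. ring. Qed.

Lemma Er_em : bigO 5 (fun t => Er t - mu * em (chain mu (t ^ 2)) x * Rpower (z t) mu).
Proof.
  assert (HC := chain6_bound_nonneg mu Hmu).
  exists (mu * (2 * chain6_bound mu) * Rpower (1 + x ^ 2) mu), 1.
  assert (HR : 0 < Rpower (1 + x ^ 2) mu) by apply exp_pos.
  repeat split; [|lra|].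
  - apply Rmult_le_pos; [|lra]. apply Rmult_le_pos; lra.
  - intros t Ht. assert (Hz := z_pos t Ht). assert (Ht2 : 0 < t ^ 2) by nra.
    unfold Er.
    replace (mu * Sg mu u (t ^ 2) * Rpower (z t) mu
             - mu * em (chain mu (t ^ 2)) x * Rpower (z t) mu)
      with (mu * Rpower (z t) mu * (Sg mu u (t ^ 2) - em (chain mu (t ^ 2)) x)) by ring.
    assert (HP : 0 < Rpower (z t) mu) by apply exp_pos.
    assert (HmP : 0 < mu * Rpower (z t) mu) by (now apply Rmult_lt_0_compat).
    rewrite Rabs_mult, (Rabs_pos_eq (mu * _)) by lra.
    assert (E := Sg_em mu u t Hmu Hu Ht). fold x in E.
    assert (Hzt : Rpower (z t) mu <= Rpower (1 + x ^ 2) mu * Rpower (t ^ 2) mu).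
    { rewrite Rpower_mult_distr by nra. apply Rle_Rpower_l; [lra|]. split; auto.
      now apply z_le. }
    apply Rle_trans with
      (mu * (Rpower (1 + x ^ 2) mu * Rpower (t ^ 2) mu)
       * (2 * chain6_bound mu * (npow (mu + 2) (t ^ 2) / t))).
    + apply Rmult_le_compat; [lra|apply Rabs_pos| |exact E].
      apply Rmult_le_compat_l; lra.
    + right.
      replace (npow (mu + 2) (t ^ 2)) with (/ Rpower (t ^ 2) mu / t ^ 4).
      * assert (Rpower (t ^ 2) mu <> 0) by (apply Rgt_not_eq, exp_pos). field. split; [lra|auto].
      * assert (N2 := npow_nat 2 (t ^ 2) Ht2).
        replace (INR 2) with 2 in N2 by (simpl; ring).
        rewrite npow_plus, npow_inv, N2. unfold Rdiv. do 2 f_equal. ring.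
Qed.

(** Evaluation of the Euler-Maclaurin main term at [x = u + 1 / 2]. *)
Lemma Er_expansion :
  bigO 5 (fun t => Er t - 1 - (mu / 12 * / z t + mu * (mu + 1) * coef2 * / z t ^ 2)).
Proof.
  pose (c3 := mu * (7 / 5760) * (48 * (mu + 1) * (mu + 1 + 1)) * x ^ 2).
  pose (c4 := mu * (7 / 5760) * (16 * (mu + 1) * (mu + 1 + 1) * (mu + 1 + 2)) * x ^ 4).
  apply (bigO_ext _ (fun t =>
    (Er t - mu * em (chain mu (t ^ 2)) x * Rpower (z t) mu)
    + ((- c3) * / z t ^ 3 + c4 * / z t ^ 4))).
  - intros t Ht. assert (Hz := z_pos t Ht).
    assert (Ezt : x ^ 2 + t ^ 2 = z t) by (unfold z; ring).
    assert (N0 : npow (mu + 0) (z t) * Rpower (z t) mu = 1).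
    { rewrite npow_Rpower. unfold npow. rewrite Ropp_0. now apply Rpower_O. }
    assert (N : forall n, npow (mu + INR n) (z t) * Rpower (z t) mu = / z t ^ n).
    { intros n. now rewrite npow_Rpower, npow_nat. }
    assert (N1 := N 1%nat). assert (N2 := N 2%nat). assert (N3 := N 3%nat).
    assert (N4 := N 4%nat).
    replace (INR 1) with 1 in N1 by (simpl; ring). replace (INR 2) with 2 in N2 by (simpl; ring).
    replace (INR 3) with 3 in N3 by (simpl; ring). replace (INR 4) with 4 in N4 by (simpl; ring).
    unfold em, chain, mono. cbv zeta. rewrite Ezt.
    replace (mu * _ * Rpower (z t) mu) with
     (npow (mu + 0) (z t) * Rpower (z t) mu
      + mu / 12 * (npow (mu + 1) (z t) * Rpower (z t) mu)
      + mu * (mu + 1) * coef2 * (npow (mu + 2) (z t) * Rpower (z t) mu)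
      - c3 * (npow (mu + 3) (z t) * Rpower (z t) mu)
      + c4 * (npow (mu + 4) (z t) * Rpower (z t) mu)).
    + rewrite N0, N1, N2, N3, N4, pow_1. ring.
    + unfold coef2, c3, c4. field. lra.
  - apply bigO_plus; [apply Er_em|]. apply bigO_plus.
    + apply bigO_scal. apply (bigO_weaken 6); [lia|]. exact (bigO_inv_z_pow 3).
    + apply bigO_scal. apply (bigO_weaken 8); [lia|]. exact (bigO_inv_z_pow 4).
Qed.

(** [ln (1 + y) = y - y ^ 2 / 2 + O (y ^ 3)], where only the first term of [y] contributes to
    [y ^ 2]. *)
Lemma ln_Er_expansion :
  bigO 5 (fun t => ln (Er t)
    - (mu / 12 * / z t + (mu * (mu + 1) * coef2 - mu ^ 2 / 288) * / z t ^ 2)).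
Proof.
  pose (y := fun t => Er t - 1).
  pose (a := fun t => mu / 12 * / z t).
  pose (r := fun t => Er t - 1 - (mu / 12 * / z t + mu * (mu + 1) * coef2 * / z t ^ 2)).
  assert (Hr : bigO 5 r) by apply Er_expansion.
  assert (Ha : bigO 2 a) by apply bigO_scal, bigO_inv_z.
  assert (Hya : bigO 4 (fun t => y t - a t)).
  { apply (bigO_ext _ (fun t => r t + mu * (mu + 1) * coef2 * / z t ^ 2)).
    - intros t _. unfold y, a, r. ring.
    - apply bigO_plus; [now apply (bigO_weaken 5); [lia|]|].
      apply bigO_scal. exact (bigO_inv_z_pow 2). }
  assert (Hy : bigO 2 y).
  { apply (bigO_ext _ (fun t => (y t - a t) + a t)); [intros; ring|].
    apply bigO_plus; auto. now apply (bigO_weaken 4); [lia|]. }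
  assert (Hln : bigO 5 (fun t => ln (1 + y t) - y t + y t ^ 2 / 2)).
  { apply (bigO_weaken (2 * 3)); [lia|].
    apply (bigO_compose (fun y => ln (1 + y) - y + y ^ 2 / 2)); [lia| |exact Hy].
    exists 2. split; [lra|]. exact ln_taylor. }
  assert (Hsq : bigO 5 (fun t => - (1 / 2) * ((y t - a t) * (y t + a t)))).
  { apply bigO_scal. apply (bigO_weaken (4 + 2)); [lia|].
    apply bigO_mult; auto. now apply bigO_plus. }
  apply (bigO_ext _ (fun t => (ln (1 + y t) - y t + y t ^ 2 / 2)
    + (- (1 / 2) * ((y t - a t) * (y t + a t)) + r t))).
  - intros t Ht. assert (Hz := z_pos t Ht).
    replace (1 + y t) with (Er t) by (unfold y; ring).
    unfold y, a, r. field. lra.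
  - apply bigO_plus; auto. now apply bigO_plus.
Qed.

Lemma ln_Gf_Er t : 1 <= t -> ln (Gf mu u (t ^ 2)) = ln (z t) - ln (Er t) / mu.
Proof.
  intros Ht. assert (Hz := z_pos t Ht).
  assert (HS : 0 < mu * Sg mu u (t ^ 2)).
  { apply Rmult_lt_0_compat; auto. apply Sg_pos; auto. nra. }
  unfold Gf, npow, Er. rewrite ln_mult; [|auto|apply exp_pos].
  unfold Rpower. rewrite !ln_exp. field. lra.
Qed.

Lemma ln_Gf_expansion :
  bigO 5 (fun t => ln (Gf mu u (t ^ 2)) - ln (z t)
    + (1 / 12 * / z t + ((mu + 1) * coef2 - mu / 288) * / z t ^ 2)).
Proof.
  apply (bigO_ext _ (fun t => - (1 / mu) * (ln (Er t)
    - (mu / 12 * / z t + (mu * (mu + 1) * coef2 - mu ^ 2 / 288) * / z t ^ 2)))).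
  - intros t Ht. rewrite ln_Gf_Er by auto. assert (Hz := z_pos t Ht). field. lra.
  - apply bigO_scal, ln_Er_expansion.
Qed.

Lemma Gf_expansion : bigO 2 (fun t => Gf mu u (t ^ 2) - z t + 1 / 12).
Proof.
  pose (l := fun t => ln (Gf mu u (t ^ 2)) - ln (z t)).
  assert (Hl : bigO 4 (fun t => l t + 1 / 12 * / z t)).
  { apply (bigO_ext _ (fun t => (l t + (1 / 12 * / z t + ((mu + 1) * coef2 - mu / 288) * / z t ^ 2))
     - ((mu + 1) * coef2 - mu / 288) * / z t ^ 2)).
    - intros; ring.
    - apply bigO_minus; [apply (bigO_weaken 5); [lia|]; apply ln_Gf_expansion|].
      apply bigO_scal. exact (bigO_inv_z_pow 2). }
  assert (Hl2 : bigO 2 l).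
  { apply (bigO_ext _ (fun t => (l t + 1 / 12 * / z t) - 1 / 12 * / z t)); [intros; ring|].
    apply bigO_minus; [now apply (bigO_weaken 4); [lia|]|].
    apply bigO_scal, bigO_inv_z. }
  assert (He : bigO 4 (fun t => exp (l t) - 1 - l t)).
  { apply (bigO_compose (fun y => exp y - 1 - y) 2 2); [lia| |exact Hl2].
    exists 3. split; [lra|]. exact exp_taylor. }
  assert (Hd := bigO_plus _ _ _ He Hl).
  destruct Hd as (K & T & HK & HT & H).
  exists (K * (1 + x ^ 2)), T. repeat split; auto; [nra|].
  intros t Ht. assert (Ht1 : 1 <= t) by lra. assert (Hz := z_pos t Ht1).
  replace (Gf mu u (t ^ 2)) with (exp (l t) * z t).
  2: { unfold l. unfold Rminus. rewrite exp_plus, exp_Ropp, !exp_ln by (auto; apply Gf_pos).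
       field. lra. }
  replace (exp (l t) * z t - z t + 1 / 12)
    with (z t * (exp (l t) - 1 - l t + (l t + 1 / 12 * / z t))) by (field; lra).
  rewrite Rabs_mult, (Rabs_pos_eq (z t)) by lra.
  apply Rle_trans with (z t * (K / t ^ 4)).
  - apply Rmult_le_compat_l; [lra|]. now apply H.
  - assert (z t <= (1 + x ^ 2) * t ^ 2) by (now apply z_le).
    replace (K * (1 + x ^ 2) / t ^ 2) with ((1 + x ^ 2) * t ^ 2 * (K / t ^ 4)) by (field; lra).
    apply Rmult_le_compat_r; auto. apply Rdiv_le_0_compat; auto. apply pow_lt; lra.
Qed.

Lemma bigO_Ff : bigO 2 (fun t => Ff mu u (t ^ 2) - (u ^ 2 + u + 1 / 6)).
Proof.
  eapply bigO_ext; [|apply Gf_expansion].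
  intros t _. unfold Ff, z, x. field.
Qed.

End Expansion.

Lemma is_lim_bigO n r l : bigO (S n) (fun t => r t - l) -> is_lim r p_infty l.
Proof.
  intros H. apply is_lim_spec. intros eps.
  destruct (bigO_small _ _ (eps / 2) ltac:(destruct eps; simpl; lra) H) as (T & HT & HH).
  exists T. intros t Ht. eapply Rle_lt_trans; [apply HH; lra|]. destruct eps; simpl; lra.
Qed.

Lemma is_lim_Ff_sqr mu u : 0 < mu -> 0 <= u ->
  is_lim (fun t => Ff mu u (t ^ 2)) p_infty (u ^ 2 + u + 1 / 6).
Proof. intros Hmu Hu. apply (is_lim_bigO 1). now apply bigO_Ff. Qed.

(** In [ln_Gf_expansion] the exponent enters only through the term in [1 / z ^ 2], with
    coefficient [1 / 288 - coef2 u = (u + 1 / 2) ^ 2 / 6 - 1 / 90 > 0]. *)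
Lemma Gf_lt_succ_eventually mu u : 0 < mu -> 0 <= u ->
  exists T, 1 <= T /\ forall t, T <= t -> Gf mu u (t ^ 2) < Gf (mu + 1) u (t ^ 2).
Proof.
  intros Hmu Hu.
  assert (H1 := ln_Gf_expansion mu u Hmu Hu).
  assert (H2 := ln_Gf_expansion (mu + 1) u ltac:(lra) Hu).
  assert (H := bigO_minus _ _ _ H2 H1).
  destruct H as (K & T & HK & HT & H).
  set (x := u + 1 / 2) in *. set (b := (1 / 24 - 1 / 90) / (1 + x ^ 2) ^ 2).
  assert (Hx2 : 1 / 4 <= x ^ 2) by (unfold x; nra).
  assert (Hb : 0 < b) by (apply Rdiv_lt_0_compat; [lra|apply pow_lt; lra]).
  exists (Rmax T (K / b + 1)). split.
  - eapply Rle_trans; [exact HT|apply Rmax_l].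
  - intros t Ht. generalize (Rmax_l T (K / b + 1)) (Rmax_r T (K / b + 1)). intros M1 M2.
    assert (Ht1 : 1 <= t) by lra.
    specialize (H t ltac:(lra)). cbv beta in H. apply Rabs_le_between in H.
    set (z := t ^ 2 + x ^ 2) in *. assert (Hz : 0 < z) by (unfold z; nra).
    assert (Hzt : z <= (1 + x ^ 2) * t ^ 2) by (now apply z_le).
    apply ln_lt_inv; try apply Gf_pos.
    assert (Hc : b / t ^ 4 <= (x ^ 2 / 6 - 1 / 90) * / z ^ 2).
    { apply Rle_trans with ((1 / 24 - 1 / 90) * / z ^ 2).
      - replace (b / t ^ 4) with ((1 / 24 - 1 / 90) * / ((1 + x ^ 2) ^ 2 * t ^ 4))
          by (unfold b; field; lra).
        apply Rmult_le_compat_l; [lra|]. apply Rinv_le_contravar; [apply pow_lt; lra|].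
        replace ((1 + x ^ 2) ^ 2 * t ^ 4) with (((1 + x ^ 2) * t ^ 2) ^ 2) by ring.
        apply pow_incr. lra.
      - apply Rmult_le_compat_r; [left; apply Rinv_0_lt_compat, pow_lt; lra|]. lra. }
    assert (Hk : K / t ^ 5 < b / t ^ 4).
    { assert (0 < t ^ 5) by (apply pow_lt; lra).
      apply (Rmult_lt_reg_r (t ^ 5)); auto.
      replace (K / t ^ 5 * t ^ 5) with K by (field; lra).
      replace (b / t ^ 4 * t ^ 5) with (b * t) by (field; lra).
      assert (K / b < t) by lra. apply (Rmult_lt_compat_l b) in H3; auto.
      replace (b * (K / b)) with K in H3 by (field; lra). lra. }
    unfold coef2 in H. fold x in H.
    replace (x ^ 2 / 6 - 1 / 90) with
      (- ((mu + 1 + 1) * (7 / 480 - x ^ 2 / 6) - (mu + 1) / 288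
       - ((mu + 1) * (7 / 480 - x ^ 2 / 6) - mu / 288))) in Hc by field.
    lra.
Qed.

(** * Fractional integration *)

Definition log_integrand (al : R) (h : R -> R) (v : R) : R := exp (al * v) * h (exp v).

(** The improper integral of [r ^ (al - 1) * h r] over [(0, +oo)], taken in the variable
    [v = ln r]: the singularity at 0 disappears, and scalings of [r] become translations. *)
Definition frac_int (al : R) (h : R -> R) (L : R) : Prop :=
  is_lim_seq (fun N => RInt (log_integrand al h) (- INR N) (INR N)) L.

Definition cont_pos (h : R -> R) : Prop := forall r, 0 < r -> continuous h r.

Lemma continuous_log_integrand al h v : cont_pos h -> continuous (log_integrand al h) v.
Proof.
  intros Hh. unfold log_integrand.
  apply (continuous_mult (fun v => exp (al * v)) (fun v => h (exp v))).
  - apply (@ex_derive_continuous R_AbsRing R_NormedModule). auto_derive; auto.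
  - apply (continuous_comp exp h).
    + apply (@ex_derive_continuous R_AbsRing R_NormedModule). auto_derive; auto.
    + apply Hh, exp_pos.
Qed.

Lemma ex_RInt_log_integrand al h a b : cont_pos h -> ex_RInt (log_integrand al h) a b.
Proof. intros Hh. apply (@ex_RInt_continuous R_CompleteNormedModule).
  intros. now apply continuous_log_integrand. Qed.

Lemma RInt_scal_log al c h a b : cont_pos h ->
  RInt (log_integrand al (fun r => c * h r)) a b = c * RInt (log_integrand al h) a b.
Proof.
  intros Ch. etransitivity.
  2: { apply (RInt_scal (V := R_CompleteNormedModule) (log_integrand al h) a b c).
       now apply ex_RInt_log_integrand. }
  apply RInt_ext. intros v _. unfold log_integrand, scal; simpl. unfold mult; simpl. ring.
Qed.

Lemma RInt_plus_log al h k a b : cont_pos h -> cont_pos k ->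
  RInt (log_integrand al (fun r => h r + k r)) a b
  = RInt (log_integrand al h) a b + RInt (log_integrand al k) a b.
Proof.
  intros Ch Ck. etransitivity.
  2: { apply (RInt_plus (V := R_CompleteNormedModule) (log_integrand al h) (log_integrand al k));
       now apply ex_RInt_log_integrand. }
  apply RInt_ext. intros v _. unfold log_integrand, plus; simpl. ring.
Qed.

Lemma cont_pos_plus h k : cont_pos h -> cont_pos k -> cont_pos (fun r => h r + k r).
Proof.
  intros Hh Hk r Hr. apply (continuous_plus h k); auto.
Qed.

Lemma cont_pos_scal c h : cont_pos h -> cont_pos (fun r => c * h r).
Proof.
  intros Hh r Hr. apply (continuous_mult (fun _ => c) h); auto. apply continuous_const.
Qed.

Lemma cont_pos_id : cont_pos (fun r => r).
Proof. intros r Hr. apply continuous_id. Qed.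

Lemma cont_pos_mult h k : cont_pos h -> cont_pos k -> cont_pos (fun r => h r * k r).
Proof.
  intros Hh Hk r Hr. apply (continuous_mult h k); auto.
Qed.

Lemma cont_pos_shift h s : (forall r, s < r -> continuous h r) -> cont_pos (fun r => h (s + r)).
Proof.
  intros Hh r Hr. apply (continuous_comp (fun r => s + r) h).
  - apply (continuous_plus (fun _ => s) (fun r => r)); [apply continuous_const|apply continuous_id].
  - apply Hh. lra.
Qed.

Lemma cont_pos_npow q z : 0 <= z -> cont_pos (fun r => npow q (z + r)).
Proof.
  intros Hz. apply cont_pos_shift. intros r Hr. apply continuous_npow. lra.
Qed.

Lemma cont_pos_Sg mu u s : 0 < mu -> 0 <= u -> 0 <= s -> cont_pos (fun r => Sg mu u (s + r)).
Proof.
  intros Hmu Hu Hs. apply cont_pos_shift. intros r Hr. apply continuous_Sg; lra.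
Qed.

Lemma frac_int_ext al h k L :
  (forall r, 0 < r -> h r = k r) -> frac_int al h L -> frac_int al k L.
Proof.
  intros E. apply is_lim_seq_ext. intros N. apply RInt_ext. intros v _.
  unfold log_integrand. rewrite E; auto. apply exp_pos.
Qed.

Lemma frac_int_plus al h k L M : cont_pos h -> cont_pos k ->
  frac_int al h L -> frac_int al k M -> frac_int al (fun r => h r + k r) (L + M).
Proof.
  intros Ch Ck Hh Hk. unfold frac_int.
  apply (is_lim_seq_ext (fun N => RInt (log_integrand al h) (- INR N) (INR N)
                                  + RInt (log_integrand al k) (- INR N) (INR N))).
  - intros N. symmetry. now apply RInt_plus_log.
  - now apply is_lim_seq_plus'.
Qed.

Lemma frac_int_scal al c h L : cont_pos h ->
  frac_int al h L -> frac_int al (fun r => c * h r) (c * L).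
Proof.
  intros Ch Hh. unfold frac_int.
  apply (is_lim_seq_ext (fun N => c * RInt (log_integrand al h) (- INR N) (INR N))).
  - intros N. symmetry. now apply RInt_scal_log.
  - apply (is_lim_seq_scal_l _ c L). exact Hh.
Qed.

Lemma frac_int_minus al h k L M : cont_pos h -> cont_pos k ->
  frac_int al h L -> frac_int al k M -> frac_int al (fun r => h r - k r) (L - M).
Proof.
  intros Ch Ck Hh Hk. replace (L - M) with (L + -1 * M) by ring.
  apply (frac_int_ext _ (fun r => h r + -1 * k r)); [intros; ring|].
  apply frac_int_plus; auto; [now apply cont_pos_scal|now apply frac_int_scal].
Qed.

Lemma frac_int_id_mult al h L : frac_int (al + 1) h L -> frac_int al (fun r => r * h r) L.
Proof.
  unfold frac_int. apply is_lim_seq_ext. intros N. apply RInt_ext. intros v _.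
  unfold log_integrand.
  replace ((al + 1) * v) with (al * v + v) by ring. rewrite exp_plus.
  rewrite Rmult_assoc. reflexivity.
Qed.

Lemma frac_int_unique al h L M : frac_int al h L -> frac_int al h M -> L = M.
Proof.
  intros HL HM. apply is_lim_seq_unique in HL. apply is_lim_seq_unique in HM. congruence.
Qed.

Lemma RInt_nonneg_mono f a b a' b' :
  (forall v, continuous f v) -> (forall v, 0 <= f v) -> a' <= a -> a <= b -> b <= b' ->
  RInt f a b <= RInt f a' b'.
Proof.
  intros Cf Pf H1 H2 H3.
  assert (Ex : forall a b, ex_RInt f a b)
    by (intros; apply (@ex_RInt_continuous R_CompleteNormedModule); auto).
  rewrite <- (RInt_Chasles f a' a b'), <- (RInt_Chasles f a b b') by auto.
  unfold plus; simpl.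
  assert (0 <= RInt f a' a) by (apply RInt_ge_0; auto).
  assert (0 <= RInt f b b') by (apply RInt_ge_0; auto). lra.
Qed.

Lemma log_integrand_nonneg al h :
  (forall r, 0 < r -> 0 <= h r) -> forall v, 0 <= log_integrand al h v.
Proof.
  intros Hh v. apply Rmult_le_pos; [left; apply exp_pos|]. apply Hh, exp_pos.
Qed.

Lemma frac_int_partial_le al h L : cont_pos h -> (forall r, 0 < r -> 0 <= h r) ->
  frac_int al h L -> forall N, RInt (log_integrand al h) (- INR N) (INR N) <= L.
Proof.
  intros Ch Ph HL N.
  apply (is_lim_seq_le_loc (fun _ => RInt (log_integrand al h) (- INR N) (INR N))
           (fun N => RInt (log_integrand al h) (- INR N) (INR N))
           (RInt (log_integrand al h) (- INR N) (INR N)) L).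
  - exists N. intros M HM. apply le_INR in HM. assert (HN := pos_INR N).
    apply RInt_nonneg_mono; try lra.
    + intros v. now apply continuous_log_integrand.
    + now apply log_integrand_nonneg.
  - apply is_lim_seq_const.
  - exact HL.
Qed.

Lemma frac_int_nonneg al h L : cont_pos h -> (forall r, 0 < r -> 0 <= h r) ->
  frac_int al h L -> 0 <= L.
Proof.
  intros Ch Ph HL. eapply Rle_trans; [|apply (frac_int_partial_le al h L Ch Ph HL 0)].
  simpl. rewrite Ropp_0, RInt_point. apply Rle_refl.
Qed.

Lemma frac_int_pos al h L : cont_pos h -> (forall r, 0 < r -> 0 < h r) ->
  frac_int al h L -> 0 < L.
Proof.
  intros Ch Ph HL.
  eapply Rlt_le_trans; [|apply (frac_int_partial_le al h L Ch) with (N := 1%nat); auto].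
  - apply RInt_gt_0; [simpl; lra| |].
    + intros v _. apply Rmult_lt_0_compat; [apply exp_pos|]. apply Ph, exp_pos.
    + intros v _. now apply continuous_log_integrand.
  - intros r Hr. left. auto.
Qed.

(** ** Powers *)

Definition beta_integrand (al q : R) : R -> R := log_integrand al (fun r => npow q (1 + r)).

Lemma beta_integrand_pos al q v : 0 < beta_integrand al q v.
Proof. apply Rmult_lt_0_compat; [apply exp_pos|apply npow_pos]. Qed.

Lemma continuous_beta_integrand al q v : continuous (beta_integrand al q) v.
Proof. apply continuous_log_integrand. apply cont_pos_npow. lra. Qed.

Lemma ex_RInt_beta al q a b : ex_RInt (beta_integrand al q) a b.
Proof. apply ex_RInt_log_integrand. apply cont_pos_npow. lra. Qed.

Lemma beta_integrand_le_left al q v : 0 < q -> beta_integrand al q v <= exp (al * v).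
Proof.
  intros Hq. unfold beta_integrand, log_integrand.
  rewrite <- (Rmult_1_r (exp (al * v))) at 2.
  apply Rmult_le_compat_l; [left; apply exp_pos|].
  replace 1 with (npow q 1) at 2.
  - apply npow_le; auto. generalize (exp_pos v). lra.
  - apply npow_base_1.
Qed.

Lemma beta_integrand_le_right al q v : 0 < q -> beta_integrand al q v <= exp (- (q - al) * v).
Proof.
  intros Hq. unfold beta_integrand, log_integrand.
  replace (exp (- (q - al) * v)) with (exp (al * v) * npow q (exp v)).
  - apply Rmult_le_compat_l; [left; apply exp_pos|].
    apply npow_le; auto. generalize (exp_pos v). lra.
  - unfold npow, Rpower. rewrite ln_exp, <- exp_plus. f_equal. ring.
Qed.

Lemma RInt_exp c a b : c <> 0 -> RInt (fun v => exp (c * v)) a b = (exp (c * b) - exp (c * a)) / c.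
Proof.
  intros Hc. apply is_RInt_unique.
  replace ((exp (c * b) - exp (c * a)) / c) with (exp (c * b) / c - exp (c * a) / c)
    by (field; auto).
  apply (is_RInt_derive (fun v => exp (c * v) / c)).
  - intros v _. auto_derive; auto. field. auto.
  - intros v _. apply (@ex_derive_continuous R_AbsRing R_NormedModule). auto_derive; auto.
Qed.

Lemma ex_RInt_exp c a b : ex_RInt (fun v => exp (c * v)) a b.
Proof.
  apply (@ex_RInt_continuous R_CompleteNormedModule). intros v _.
  apply (@ex_derive_continuous R_AbsRing R_NormedModule). auto_derive; auto.
Qed.

Lemma beta_bounded al q N : 0 < al < q ->
  RInt (beta_integrand al q) (- INR N) (INR N) <= / al + / (q - al).
Proof.
  intros Hal. assert (HN := pos_INR N).
  rewrite <- (RInt_Chasles _ (- INR N) 0 (INR N)) by apply ex_RInt_beta.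
  apply Rplus_le_compat.
  - apply Rle_trans with (RInt (fun v => exp (al * v)) (- INR N) 0).
    + apply RInt_le; [lra|apply ex_RInt_beta|apply ex_RInt_exp|].
      intros v _. apply beta_integrand_le_left. lra.
    + rewrite RInt_exp by lra. rewrite Rmult_0_r, exp_0.
      unfold Rdiv. rewrite <- (Rmult_1_l (/ al)) at 2.
      apply Rmult_le_compat_r; [left; apply Rinv_0_lt_compat; lra|].
      generalize (exp_pos (al * - INR N)). lra.
  - apply Rle_trans with (RInt (fun v => exp (- (q - al) * v)) 0 (INR N)).
    + apply RInt_le; [lra|apply ex_RInt_beta|apply ex_RInt_exp|].
      intros v _. apply beta_integrand_le_right. lra.
    + rewrite RInt_exp by lra. rewrite Rmult_0_r, exp_0.
      replace ((exp (- (q - al) * INR N) - 1) / - (q - al))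
        with ((1 - exp (- (q - al) * INR N)) * / (q - al)) by (field; lra).
      rewrite <- (Rmult_1_l (/ (q - al))) at 2.
      apply Rmult_le_compat_r; [left; apply Rinv_0_lt_compat; lra|].
      generalize (exp_pos (- (q - al) * INR N)). lra.
Qed.

(** In the classical notation this is the Beta function [B (al, q - al)]. *)
Definition Beta (al q : R) : R :=
  real (Lim_seq (fun N => RInt (beta_integrand al q) (- INR N) (INR N))).

Lemma frac_int_Beta al q : 0 < al < q -> frac_int al (fun r => npow q (1 + r)) (Beta al q).
Proof.
  intros Hal. unfold frac_int, Beta. apply Lim_seq_correct'.
  apply (ex_finite_lim_seq_incr _ (/ al + / (q - al))).
  - intros N. rewrite S_INR. assert (HN := pos_INR N). apply RInt_nonneg_mono; try lra.
    + apply continuous_beta_integrand.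
    + intros v. left. apply beta_integrand_pos.
  - intros N. now apply beta_bounded.
Qed.

Lemma Beta_pos al q : 0 < al < q -> 0 < Beta al q.
Proof.
  intros Hal. apply (frac_int_pos al (fun r => npow q (1 + r))).
  - apply cont_pos_npow. lra.
  - intros r _. apply npow_pos.
  - now apply frac_int_Beta.
Qed.

(** The substitution [r = z * r'] translates [v] by [ln z]; as the integrand is positive, the
    translated windows are squeezed between the symmetric ones. *)
Lemma frac_int_npow al q z : 0 < al < q -> 0 < z ->
  frac_int al (fun r => npow q (z + r)) (Beta al q * npow (q - al) z).
Proof.
  intros Hal Hz. set (c := ln z).
  assert (Hk : forall v, log_integrand al (fun r => npow q (z + r)) v
                         = npow (q - al) z * beta_integrand al q (1 * v + - c)).
  { intros v. unfold beta_integrand, log_integrand.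
    replace (exp (1 * v + - c)) with (exp v / z).
    2: { rewrite Rmult_1_l, exp_plus, exp_Ropp. unfold c. now rewrite exp_ln. }
    replace (z + exp v) with (z * (1 + exp v / z)) by (field; lra).
    rewrite npow_mult_base; auto.
    2: { apply Rplus_lt_0_compat; [lra|]. apply Rdiv_lt_0_compat; auto. apply exp_pos. }
    replace (exp (al * (1 * v + - c))) with (exp (al * v) * npow al z).
    2: { unfold npow, Rpower. rewrite <- exp_plus. f_equal. unfold c. ring. }
    replace q with (q - al + al) at 1 by ring. rewrite npow_plus. ring. }
  assert (Hc : exists m, Rabs c <= INR m).
  { destruct (nfloor_ex (Rabs c) (Rabs_pos c)) as [m Hm]. exists (S m). rewrite S_INR. lra. }
  destruct Hc as [m Hm]. apply Rabs_le_between in Hm.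
  assert (Hshift : is_lim_seq
    (fun N => RInt (beta_integrand al q) (1 * - INR N + - c) (1 * INR N + - c)) (Beta al q)).
  { apply (is_lim_seq_incr_n _ m).
    apply (is_lim_seq_le_le (fun N => RInt (beta_integrand al q) (- INR N) (INR N)) _
             (fun N => RInt (beta_integrand al q) (- INR (N + m + m)) (INR (N + m + m)))).
    - intros N. rewrite !plus_INR. assert (HN := pos_INR N).
      split; apply RInt_nonneg_mono; try lra; try apply continuous_beta_integrand;
        intros v; left; apply beta_integrand_pos.
    - now apply frac_int_Beta.
    - apply (is_lim_seq_incr_n
               (fun N => RInt (beta_integrand al q) (- INR (N + m)) (INR (N + m))) m).
      apply (is_lim_seq_incr_n (fun N => RInt (beta_integrand al q) (- INR N) (INR N)) m).
      now apply frac_int_Beta. }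
  unfold frac_int. rewrite Rmult_comm.
  apply (is_lim_seq_ext (fun N => npow (q - al) z *
     RInt (beta_integrand al q) (1 * - INR N + - c) (1 * INR N + - c))).
  - intros N. rewrite <- (RInt_comp_lin (beta_integrand al q)) by apply ex_RInt_beta.
    symmetry. etransitivity.
    2: { apply (RInt_scal (V := R_CompleteNormedModule)
                  (fun v => scal 1 (beta_integrand al q (1 * v + - c)))).
         apply (ex_RInt_comp_lin (beta_integrand al q)). apply ex_RInt_beta. }
    apply RInt_ext. intros v _. rewrite Hk. unfold scal; simpl. unfold mult; simpl. ring.
  - apply (is_lim_seq_scal_l _ (npow (q - al) z) (Beta al q)). exact Hshift.
Qed.

(** The derivative of [beta_integrand al q] is [(al - q)] times itself plus [q] times
    [beta_integrand al (q + 1)], and it integrates to 0. *)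
Lemma Beta_succ_r al q : 0 < al < q -> (q - al) * Beta al q = q * Beta al (q + 1).
Proof.
  intros Hal.
  pose (h := fun r => (al - q) * npow q (1 + r) + q * npow (q + 1) (1 + r)).
  assert (C1 : cont_pos (fun r => npow q (1 + r))) by (apply cont_pos_npow; lra).
  assert (C2 : cont_pos (fun r => npow (q + 1) (1 + r))) by (apply cont_pos_npow; lra).
  assert (H1 : frac_int al h ((al - q) * Beta al q + q * Beta al (q + 1))).
  { apply (frac_int_plus al (fun r => (al - q) * npow q (1 + r))
             (fun r => q * npow (q + 1) (1 + r))); try now apply cont_pos_scal.
    - apply frac_int_scal; auto. now apply frac_int_Beta.
    - apply frac_int_scal; auto. apply frac_int_Beta. lra. }
  assert (H2 : frac_int al h 0).
  { unfold frac_int.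
    apply (is_lim_seq_ext (fun N => beta_integrand al q (INR N) - beta_integrand al q (- INR N))).
    - intros N. symmetry. apply is_RInt_unique.
      apply (is_RInt_derive (beta_integrand al q)).
      + intros v _.
        assert (D1 : is_derive (fun v => exp (al * v)) v (al * exp (al * v))).
        { auto_derive; auto. ring. }
        assert (D2 : is_derive (fun v => npow q (1 + exp v)) v
                       (exp v * (- q * npow (q + 1) (1 + exp v)))).
        { apply (is_derive_comp (npow q) (fun v => 1 + exp v)).
          - apply is_derive_npow. generalize (exp_pos v). lra.
          - auto_derive; auto. ring. }
        evar_last; [exact (is_derive_mult _ _ _ _ _ D1 D2 Rmult_comm)|].
        unfold log_integrand, h, plus, mult; simpl.
        assert (Hv : 0 < 1 + exp v) by (generalize (exp_pos v); lra).
        rewrite (npow_succ q) by auto. field. lra.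
      + intros v _. apply continuous_log_integrand.
        apply cont_pos_plus; now apply cont_pos_scal.
    - replace (Finite 0) with (Finite (0 - 0)) by (f_equal; ring).
      assert (Hexp : forall c, 0 < c -> is_lim_seq (fun N => exp (- c * INR N)) 0).
      { intros c Hc. apply (is_lim_comp_seq exp (fun N => - c * INR N) m_infty 0).
        - apply is_lim_exp_m.
        - exists 0%nat. intros; discriminate.
        - evar_last; [apply is_lim_seq_scal_l, is_lim_seq_INR|].
          simpl. destruct (Rle_dec 0 (- c)) as [H|H]; [exfalso; lra|reflexivity]. }
      apply is_lim_seq_minus'.
      + apply (is_lim_seq_le_le (fun _ => 0) _ (fun N => exp (- (q - al) * INR N))).
        * intros N. split; [left; apply beta_integrand_pos|].
          apply beta_integrand_le_right. lra.
        * apply is_lim_seq_const.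
        * apply Hexp. lra.
      + apply (is_lim_seq_le_le (fun _ => 0) _ (fun N => exp (- al * INR N))).
        * intros N. split; [left; apply beta_integrand_pos|].
          replace (- al * INR N) with (al * - INR N) by ring.
          apply beta_integrand_le_left. lra.
        * apply is_lim_seq_const.
        * apply Hexp. lra. }
  assert (E := frac_int_unique _ _ _ _ H1 H2). lra.
Qed.

Lemma Beta_succ_both al q : 0 < al < q -> Beta (al + 1) (q + 1) = Beta al q - Beta al (q + 1).
Proof.
  intros Hal.
  assert (C1 : cont_pos (fun r => npow q (1 + r))) by (apply cont_pos_npow; lra).
  assert (C2 : cont_pos (fun r => npow (q + 1) (1 + r))) by (apply cont_pos_npow; lra).
  apply (frac_int_unique al (fun r => r * npow (q + 1) (1 + r))).
  - apply frac_int_id_mult, frac_int_Beta. lra.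
  - apply (frac_int_ext al (fun r => npow q (1 + r) - npow (q + 1) (1 + r))).
    + intros r Hr. rewrite (npow_succ q) by lra. field. lra.
    + apply frac_int_minus; auto; apply frac_int_Beta; lra.
Qed.

(** By [Beta_succ_r] the constant is the same as for the series below. *)
Lemma frac_int_npow_div al nu z : 0 < al < nu -> 0 < z ->
  frac_int al (fun r => npow nu (z + r) / nu)
    (Beta al (nu + 1) * (npow (nu - al) z / (nu - al))).
Proof.
  intros Hal Hz.
  replace (Beta al (nu + 1) * (npow (nu - al) z / (nu - al)))
    with (/ nu * (Beta al nu * npow (nu - al) z)).
  - apply (frac_int_ext al (fun r => / nu * npow nu (z + r))); [intros; field; lra|].
    apply frac_int_scal; [apply cont_pos_npow; lra|]. now apply frac_int_npow.
  - assert (E := Beta_succ_r al nu Hal).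
    replace (Beta al (nu + 1)) with ((nu - al) * Beta al nu / nu).
    + field. lra.
    + rewrite E. field. lra.
Qed.

(** ** The series *)

Fixpoint psum (n : nat) (mu u s : R) : R :=
  match n with
  | O => 0
  | S m => mterm mu u s 0 + psum m mu (u + 1) s
  end.

Lemma Sg_psum n : forall mu u s, 0 < mu -> 0 <= u -> - (1 / 2) <= s ->
  Sg mu u s = psum n mu u s + Sg mu (u + INR n) s.
Proof.
  induction n as [|n IH]; intros mu u s Hmu Hu Hs.
  - simpl. rewrite Rplus_0_r. ring.
  - cbn [psum]. rewrite Sg_shift by auto. rewrite (IH mu (u + 1) s) by (auto; lra).
    rewrite S_INR. replace (u + 1 + INR n) with (u + (INR n + 1)) by ring. ring.
Qed.

Lemma mterm_shift_arg nu u s k r :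
  mterm nu u (s + r) k = 2 * pt u k * npow (nu + 1) (pt u k ^ 2 + s + r).
Proof. unfold mterm. now rewrite Rplus_assoc. Qed.

Lemma cont_pos_ext h k : (forall r, h r = k r) -> cont_pos h -> cont_pos k.
Proof.
  intros E Ch r Hr. apply (continuous_ext h); auto.
Qed.

Lemma frac_int_psum al nu s : 0 < al < nu -> 0 <= s -> forall n u, 0 <= u ->
  cont_pos (fun r => psum n nu u (s + r)) /\
  frac_int al (fun r => psum n nu u (s + r)) (Beta al (nu + 1) * psum n (nu - al) u s).
Proof.
  intros Hal Hs n. induction n as [|n IH]; intros u Hu.
  - simpl. split.
    + intros r Hr. apply continuous_const.
    + apply (is_lim_seq_ext (fun _ => 0)).
      * intros N. symmetry.
        rewrite (RInt_ext _ (fun _ => 0)), RInt_const.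
        -- unfold scal; simpl. unfold mult; simpl. ring.
        -- intros v _. unfold log_integrand. apply Rmult_0_r.
      * rewrite Rmult_0_r. apply is_lim_seq_const.
  - assert (Hp := pt_ge u 0 Hu). destruct (IH (u + 1) ltac:(lra)) as [C1 F1].
    assert (Cn : cont_pos (fun r => npow (nu + 1) (pt u 0 ^ 2 + s + r)))
      by (apply cont_pos_npow; nra).
    assert (C0 : cont_pos (fun r => mterm nu u (s + r) 0)).
    { apply (cont_pos_ext (fun r => 2 * pt u 0 * npow (nu + 1) (pt u 0 ^ 2 + s + r))).
      - intros r. symmetry. apply mterm_shift_arg.
      - now apply cont_pos_scal. }
    cbn [psum]. split; [now apply cont_pos_plus|].
    rewrite Rmult_plus_distr_l. apply frac_int_plus; auto.
    apply (frac_int_ext al (fun r => 2 * pt u 0 * npow (nu + 1) (pt u 0 ^ 2 + s + r))).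
    + intros r Hr. symmetry. apply mterm_shift_arg.
    + replace (Beta al (nu + 1) * mterm (nu - al) u s 0)
        with (2 * pt u 0 * (Beta al (nu + 1) * npow (nu + 1 - al) (pt u 0 ^ 2 + s))).
      * apply frac_int_scal; auto. apply frac_int_npow; [lra|nra].
      * unfold mterm. replace (nu + 1 - al) with (nu - al + 1) by ring. ring.
Qed.

Lemma npow_midpoint_lim mu u s : 0 < mu -> 0 <= u -> 0 <= s ->
  is_lim_seq (fun n => npow mu (s + ((u + INR n) ^ 2 + (u + INR n)))) 0.
Proof.
  intros Hmu Hu Hs. apply is_lim_seq_npow; auto.
  apply (is_lim_seq_le_p_loc INR); [|apply is_lim_seq_INR].
  exists 0%nat. intros n _. generalize (pos_INR n). nra.
Qed.

(** Integration of order [al] lowers the exponent by [al]. The tails of the series are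
    controlled uniformly by the midpoint bound. *)
Lemma frac_int_Sg al nu u s : 0 < al < nu -> 0 <= u -> 0 <= s ->
  frac_int al (fun r => Sg nu u (s + r)) (Beta al (nu + 1) * Sg (nu - al) u s).
Proof.
  intros Hal Hu Hs. set (mu := nu - al). assert (Hmu : 0 < mu) by (unfold mu; lra).
  set (B := Beta al (nu + 1)). assert (HB : 0 < B) by (apply Beta_pos; lra).
  apply is_lim_seq_spec. intros eps.
  set (w := fun n => s + ((u + INR n) ^ 2 + (u + INR n))).
  assert (Hw : is_lim_seq (fun n => B / mu * npow mu (w n)) 0).
  { replace (Finite 0) with (Rbar_mult (B / mu) 0) by (simpl; f_equal; ring).
    apply is_lim_seq_scal_l. now apply npow_midpoint_lim. }
  apply is_lim_seq_spec in Hw.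
  destruct (Hw (pos_div_2 eps)) as [n0 Hn0].
  set (n := S n0). specialize (Hn0 n (Nat.le_succ_diag_r n0)). simpl in Hn0.
  assert (HnR : 1 <= INR n) by (unfold n; rewrite S_INR; generalize (pos_INR n0); lra).
  clearbody n. clear n0.
  assert (Hwn : 0 < w n) by (unfold w; nra).
  rewrite Rminus_0_r in Hn0. apply Rabs_lt_between in Hn0.
  assert (Hun : 0 <= u + INR n) by lra.
  destruct (frac_int_psum al nu s Hal Hs n u Hu) as [Cp Fp]. fold mu B in Fp.
  apply is_lim_seq_spec in Fp. destruct (Fp (pos_div_2 eps)) as [N0 HN0].
  exists N0. intros N HN. specialize (HN0 N HN). simpl in HN0.
  assert (CS : cont_pos (fun r => Sg nu (u + INR n) (s + r))) by (apply cont_pos_Sg; lra).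
  assert (Esplit : RInt (log_integrand al (fun r => Sg nu u (s + r))) (- INR N) (INR N)
    = RInt (log_integrand al (fun r => psum n nu u (s + r))) (- INR N) (INR N)
      + RInt (log_integrand al (fun r => Sg nu (u + INR n) (s + r))) (- INR N) (INR N)).
  { rewrite <- RInt_plus_log by auto.
    apply RInt_ext. intros v _. unfold log_integrand.
    rewrite (Sg_psum n nu u) by (generalize (exp_pos v); lra). reflexivity. }
  assert (Cw : cont_pos (fun r => npow nu (w n + r) / nu)).
  { apply (cont_pos_ext (fun r => / nu * npow nu (w n + r))).
    - intros r. unfold Rdiv. ring.
    - apply cont_pos_scal, cont_pos_npow. lra. }
  assert (Htail :
    0 <= RInt (log_integrand al (fun r => Sg nu (u + INR n) (s + r))) (- INR N) (INR N)
      <= B / mu * npow mu (w n)).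
  { assert (HNp := pos_INR N). split.
    - apply RInt_ge_0; [lra|now apply ex_RInt_log_integrand|].
      intros v _. apply log_integrand_nonneg. intros r Hr. apply Sg_nonneg; lra.
    - apply Rle_trans with
        (RInt (log_integrand al (fun r => npow nu (w n + r) / nu)) (- INR N) (INR N)).
      + apply RInt_le; [lra|now apply ex_RInt_log_integrand|now apply ex_RInt_log_integrand|].
        intros v _. apply Rmult_le_compat_l; [left; apply exp_pos|].
        assert (Hv := exp_pos v).
        destruct (Sg_midpoint nu (u + INR n) (s + exp v)) as [_ H]; try lra; [nra|].
        left. eapply Rlt_le_trans; [exact H|]. right. do 2 f_equal. unfold w. ring.
      + eapply Rle_trans.
        * apply frac_int_partial_le; [exact Cw| |now apply frac_int_npow_div].
          intros r Hr. left. apply Rdiv_lt_0_compat; [apply npow_pos|lra].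
        * right. fold mu B. field. lra. }
  assert (Hmid : 0 <= B * Sg mu (u + INR n) s <= B / mu * npow mu (w n)).
  { split.
    - apply Rmult_le_pos; [lra|]. apply Sg_nonneg; lra.
    - destruct (Sg_midpoint mu (u + INR n) s) as [_ H]; try lra; [nra|].
      replace (B / mu * npow mu (w n)) with (B * (npow mu (w n) / mu)) by (field; lra).
      apply Rmult_le_compat_l; [lra|]. left. exact H. }
  rewrite Esplit, (Sg_psum n mu u s) by lra.
  apply Rabs_lt_between in HN0. apply Rabs_lt_between. lra.
Qed.

(** * Monotonicity in the exponent *)

(** Fractional integration of order [nu - mu] lowers the exponent of the series and of the
    power that bounds it with the same constant, hence it lowers the exponent of their gap. *)
Lemma frac_int_gap mu nu u s b : 0 < mu < nu -> 0 <= u -> 0 <= s -> 0 < s + b ->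
  let h := fun r => npow nu (s + b + r) / nu - Sg nu u (s + r) in
  cont_pos h /\
  frac_int (nu - mu) h (Beta (nu - mu) (nu + 1) * (npow mu (s + b) / mu - Sg mu u s)).
Proof.
  intros Hmu Hu Hs Hb h.
  assert (Hal : 0 < nu - mu < nu) by lra.
  assert (F1 := frac_int_Sg (nu - mu) nu u s Hal Hu Hs).
  assert (F2 := frac_int_npow_div (nu - mu) nu (s + b) Hal Hb).
  replace (nu - (nu - mu)) with mu in F1, F2 by ring.
  assert (C1 : cont_pos (fun r => Sg nu u (s + r))) by (apply cont_pos_Sg; lra).
  assert (C2 : cont_pos (fun r => npow nu (s + b + r) / nu)).
  { apply (cont_pos_ext (fun r => / nu * npow nu (s + b + r))).
    - intros r. unfold Rdiv. ring.
    - apply cont_pos_scal, cont_pos_npow. lra. }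
  split.
  - apply (cont_pos_ext (fun r => npow nu (s + b + r) / nu + -1 * Sg nu u (s + r))).
    + intros r. unfold h. ring.
    + apply cont_pos_plus; auto. now apply cont_pos_scal.
  - rewrite Rmult_minus_distr_l. now apply frac_int_minus.
Qed.

Lemma Ff_ge_descend mu nu u s b : 0 < mu < nu -> 0 <= u -> 0 <= s -> 0 < b ->
  (forall r, 0 < r -> b <= Ff nu u (s + r)) -> b <= Ff mu u s.
Proof.
  intros Hmu Hu Hs Hb H. apply Ff_ge_iff; try lra.
  assert (HB := Beta_pos (nu - mu) (nu + 1) ltac:(lra)).
  destruct (frac_int_gap mu nu u s b Hmu Hu Hs ltac:(lra)) as [Ch Fh].
  apply frac_int_nonneg in Fh; auto.
  - apply Rminus_le_0. apply (Rmult_le_reg_l _ _ _ HB). lra.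
  - intros r Hr. specialize (H r Hr). apply Ff_ge_iff in H; try lra.
    replace (s + r + b) with (s + b + r) in H by ring. lra.
Qed.

Lemma Ff_gt_descend mu nu u s b : 0 < mu < nu -> 0 <= u -> 0 <= s -> 0 < b ->
  (forall r, 0 < r -> b < Ff nu u (s + r)) -> b < Ff mu u s.
Proof.
  intros Hmu Hu Hs Hb H. apply Ff_gt_iff; try lra.
  assert (HB := Beta_pos (nu - mu) (nu + 1) ltac:(lra)).
  destruct (frac_int_gap mu nu u s b Hmu Hu Hs ltac:(lra)) as [Ch Fh].
  apply frac_int_pos in Fh; auto.
  - apply Rminus_lt_0. apply (Rmult_lt_reg_l _ _ _ HB). lra.
  - intros r Hr. specialize (H r Hr). apply Ff_gt_iff in H; try lra.
    replace (s + r + b) with (s + b + r) in H by ring. lra.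
Qed.

Lemma Ff_le_descend mu nu u s a : 0 < mu < nu -> 0 <= u -> 0 <= s -> 0 < a ->
  (forall r, 0 < r -> Ff nu u (s + r) <= a) -> Ff mu u s <= a.
Proof.
  intros Hmu Hu Hs Hb H. apply Ff_le_iff; try lra.
  assert (HB := Beta_pos (nu - mu) (nu + 1) ltac:(lra)).
  destruct (frac_int_gap mu nu u s a Hmu Hu Hs ltac:(lra)) as [Ch Fh].
  apply (frac_int_scal _ (-1)) in Fh; auto. apply frac_int_nonneg in Fh.
  - apply Rminus_le_0. apply (Rmult_le_reg_l _ _ _ HB). lra.
  - now apply cont_pos_scal.
  - intros r Hr. specialize (H r Hr). apply Ff_le_iff in H; try lra.
    replace (s + r + a) with (s + a + r) in H by ring. lra.
Qed.

(** The same descent for the quantity that decides the sign of the derivative of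
    [(s + a) ^ mu S_mu]. The term with the additional factor [r] is a fractional integral of order
    [al + 1]; through [Beta_succ_both] it turns the factor [nu] of [S_mu] into [mu]. *)
Lemma log_slope_descend mu nu u s a : 0 < mu < nu -> 0 <= u -> 0 <= s ->
  (forall r, 0 < r ->
     0 < nu * Sg nu u (s + r) - (s + r + a) * ((nu + 1) * Sg (nu + 1) u (s + r))) ->
  0 < mu * Sg mu u s - (s + a) * ((mu + 1) * Sg (mu + 1) u s).
Proof.
  intros Hmu Hu Hs H. set (al := nu - mu). assert (Hal : 0 < al < nu) by (unfold al; lra).
  assert (C1 : cont_pos (fun r => Sg nu u (s + r))) by (apply cont_pos_Sg; lra).
  assert (C2 : cont_pos (fun r => Sg (nu + 1) u (s + r))) by (apply cont_pos_Sg; lra).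
  assert (C3 := cont_pos_mult _ _ cont_pos_id C2).
  assert (F1 := frac_int_Sg al nu u s Hal Hu Hs).
  assert (F2 := frac_int_Sg al (nu + 1) u s ltac:(lra) Hu Hs).
  assert (F3 := frac_int_id_mult _ _ _ (frac_int_Sg (al + 1) (nu + 1) u s ltac:(lra) Hu Hs)).
  replace (nu - al) with mu in F1 by (unfold al; ring).
  replace (nu + 1 - al) with (mu + 1) in F2 by (unfold al; ring).
  replace (nu + 1 - (al + 1)) with mu in F3 by (unfold al; ring).
  assert (HB := Beta_pos al (nu + 1) ltac:(lra)).
  assert (E1 := Beta_succ_r al (nu + 1) ltac:(lra)).
  assert (E2 := Beta_succ_both al (nu + 1) ltac:(lra)).
  assert (F := frac_int_plus _ _ _ _ _ (cont_pos_scal nu _ C1)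
    (cont_pos_plus _ _ (cont_pos_scal (- ((s + a) * (nu + 1))) _ C2)
       (cont_pos_scal (- (nu + 1)) _ C3))
    (frac_int_scal _ nu _ _ C1 F1)
    (frac_int_plus _ _ _ _ _ (cont_pos_scal _ _ C2) (cont_pos_scal _ _ C3)
      (frac_int_scal _ (- ((s + a) * (nu + 1))) _ _ C2 F2)
      (frac_int_scal _ (- (nu + 1)) _ _ C3 F3))).
  apply frac_int_pos in F.
  - apply (Rmult_lt_reg_l _ _ _ HB). rewrite Rmult_0_r.
    eapply Rlt_le_trans; [exact F|]. right.
    rewrite E2. set (B' := Beta al (nu + 1 + 1)) in *. set (B := Beta al (nu + 1)) in *.
    assert (EB : (nu + 1) * B' = (mu + 1) * B) by (rewrite <- E1; unfold al; ring).
    replace (nu * (B * Sg mu u s) + (- ((s + a) * (nu + 1)) * (B' * Sg (mu + 1) u s)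
              + - (nu + 1) * ((B - B') * Sg mu u s)))
      with (nu * (B * Sg mu u s) - (s + a) * ((nu + 1) * B') * Sg (mu + 1) u s
              - (nu + 1) * B * Sg mu u s + (nu + 1) * B' * Sg mu u s) by ring.
    rewrite EB. ring.
  - apply cont_pos_plus; [now apply cont_pos_scal|].
    apply cont_pos_plus; now apply cont_pos_scal.
  - intros r Hr. specialize (H r Hr). lra.
Qed.

(** * Extremal values *)

Lemma is_derive_f_fun mu u t : 0 < mu -> 0 <= u ->
  is_derive (f_fun mu u) t
    (2 * t * (npow (mu + 1) (Gf (mu + 1) u (t ^ 2) / Gf mu u (t ^ 2)) - 1)).
Proof.
  intros Hmu Hu.
  apply (is_derive_ext (fun t => Ff mu u (t ^ 2))); [intros; now rewrite f_fun_Ff|].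
  apply (is_derive_comp (Ff mu u) (fun t => t ^ 2)).
  - apply is_derive_Ff; auto. nra.
  - auto_derive; auto. ring.
Qed.

Lemma continuous_f_fun mu u t : 0 < mu -> 0 <= u -> continuous (f_fun mu u) t.
Proof.
  intros Hmu Hu. apply (@ex_derive_continuous R_AbsRing R_NormedModule).
  eexists. now apply is_derive_f_fun.
Qed.

Lemma is_lim_f_fun mu u : 0 < mu -> 0 <= u ->
  is_lim (f_fun mu u) p_infty (u ^ 2 + u + 1 / 6).
Proof.
  intros Hmu Hu. apply (is_lim_ext (fun t => Ff mu u (t ^ 2))).
  - intros t. now rewrite f_fun_Ff.
  - now apply is_lim_Ff_sqr.
Qed.

Lemma f_infty_eq mu u : 0 < mu -> 0 <= u -> f_infty mu u = u ^ 2 + u + 1 / 6.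
Proof.
  intros Hmu Hu. unfold f_infty. now rewrite (is_lim_unique _ _ _ (is_lim_f_fun mu u Hmu Hu)).
Qed.

(** A continuous function that stays above [c], including in the limit, is bounded
    away from [c] on a half-line. *)
Lemma bounded_away (phi : R -> R) c L :
  (forall t, continuous phi t) -> (forall t, c < phi t) -> is_lim phi p_infty (Finite L) ->
  c < L -> exists d, c < d /\ forall t, 0 <= t -> d <= phi t.
Proof.
  intros Hc Hphi Hlim HL. apply is_lim_spec in Hlim.
  assert (He : 0 < (L - c) / 2) by lra.
  destruct (Hlim (mkposreal _ He)) as [T HT]. simpl in HT.
  destruct (continuity_ab_min phi 0 (Rmax T 0)) as [t0 [Ht0 _]].
  - apply Rmax_r.
  - intros t _. apply continuity_pt_filterlim. apply Hc.
  - exists (Rmin (phi t0) ((L + c) / 2)). split.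
    + apply Rmin_glb_lt; [auto|lra].
    + intros t Ht. destruct (Rle_lt_dec t (Rmax T 0)) as [H|H].
      * eapply Rle_trans; [apply Rmin_l|]. now apply Ht0.
      * eapply Rle_trans; [apply Rmin_r|].
        assert (HtT : T < t) by (eapply Rle_lt_trans; [apply Rmax_l|exact H]).
        specialize (HT t HtT). apply Rabs_lt_between in HT. lra.
Qed.

Lemma f_fun_gt_low mu u t : 0 < mu -> 0 <= u -> u ^ 2 + u < f_fun mu u t.
Proof. intros Hmu Hu. rewrite f_fun_Ff. apply Ff_gt_low; auto. nra. Qed.

Lemma f_fun_lt_high mu u t : 0 < mu -> 0 <= u -> f_fun mu u t < (1 + u) ^ 2.
Proof. intros Hmu Hu. rewrite f_fun_Ff. apply Ff_lt_high; auto. nra. Qed.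

Lemma m_inf_spec mu u : 0 < mu -> 0 <= u ->
  exists m, m_inf mu u = Finite m /\ (forall t, 0 <= t -> m <= f_fun mu u t) /\
    (forall b, (forall t, 0 <= t -> b <= f_fun mu u t) -> b <= m).
Proof.
  intros Hmu Hu. unfold m_inf.
  destruct (Glb_Rbar_correct (f_values mu u)) as [H1 H2].
  assert (H3 : Rbar_le (Finite (u ^ 2 + u)) (Glb_Rbar (f_values mu u))).
  { apply H2. intros y (t & Ht & ->). simpl. left. now apply f_fun_gt_low. }
  assert (H4 : Rbar_le (Glb_Rbar (f_values mu u)) (Finite (f_fun mu u 0))).
  { apply H1. exists 0. split; auto. lra. }
  destruct (Glb_Rbar (f_values mu u)) as [m| |]; try easy.
  exists m. split; [reflexivity|]. split.
  - intros t Ht. apply (H1 (f_fun mu u t)). now exists t.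
  - intros b Hb. apply (H2 (Finite b)). intros y (t & Ht & ->). now apply Hb.
Qed.

Lemma M_sup_spec mu u : 0 < mu -> 0 <= u ->
  exists M, M_sup mu u = Finite M /\ (forall t, 0 <= t -> f_fun mu u t <= M) /\
    (forall a, (forall t, 0 <= t -> f_fun mu u t <= a) -> M <= a).
Proof.
  intros Hmu Hu. unfold M_sup.
  destruct (Lub_Rbar_correct (f_values mu u)) as [H1 H2].
  assert (H3 : Rbar_le (Lub_Rbar (f_values mu u)) (Finite ((1 + u) ^ 2))).
  { apply H2. intros y (t & Ht & ->). simpl. left. now apply f_fun_lt_high. }
  assert (H4 : Rbar_le (Finite (f_fun mu u 0)) (Lub_Rbar (f_values mu u))).
  { apply H1. exists 0. split; auto. lra. }
  destruct (Lub_Rbar (f_values mu u)) as [M| |]; try easy.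
  exists M. split; [reflexivity|]. split.
  - intros t Ht. apply (H1 (f_fun mu u t)). now exists t.
  - intros a Ha. apply (H2 (Finite a)). intros y (t & Ht & ->). now apply Ha.
Qed.

Lemma f_fun_lim_le mu u b : 0 < mu -> 0 <= u ->
  (forall t, 0 <= t -> b <= f_fun mu u t) -> b <= u ^ 2 + u + 1 / 6.
Proof.
  intros Hmu Hu Hb.
  apply (is_lim_le_loc (fun _ => b) (f_fun mu u) p_infty b (u ^ 2 + u + 1 / 6)).
  - exists 0. intros t Ht. apply Hb. lra.
  - apply is_lim_const.
  - now apply is_lim_f_fun.
Qed.

Lemma m_inf_range mu u : 0 < mu -> 0 <= u ->
  exists m, m_inf mu u = Finite m /\ u ^ 2 + u < m <= u ^ 2 + u + 1 / 6 /\
    (forall t, 0 <= t -> m <= f_fun mu u t) /\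
    (forall b, (forall t, 0 <= t -> b <= f_fun mu u t) -> b <= m).
Proof.
  intros Hmu Hu. destruct (m_inf_spec mu u Hmu Hu) as (m & E & H1 & H2).
  exists m. repeat split; auto.
  - destruct (bounded_away (f_fun mu u) (u ^ 2 + u) (u ^ 2 + u + 1 / 6)) as (d & Hd & Hdt).
    + intros t. now apply continuous_f_fun.
    + intros t. now apply f_fun_gt_low.
    + now apply is_lim_f_fun.
    + lra.
    + specialize (H2 d Hdt). lra.
  - now apply (f_fun_lim_le mu).
Qed.

Lemma M_sup_range mu u : 0 < mu -> 0 <= u ->
  exists M, M_sup mu u = Finite M /\ u ^ 2 + u + 1 / 4 < M < (1 + u) ^ 2 /\
    (forall t, 0 <= t -> f_fun mu u t <= M) /\
    (forall a, (forall t, 0 <= t -> f_fun mu u t <= a) -> M <= a).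
Proof.
  intros Hmu Hu. destruct (M_sup_spec mu u Hmu Hu) as (M & E & H1 & H2).
  exists M. repeat split; auto.
  - eapply Rlt_le_trans; [now apply (Ff_zero_gt mu)|].
    specialize (H1 0 ltac:(lra)). rewrite f_fun_Ff in H1.
    now replace (0 ^ 2) with 0 in H1 by ring.
  - destruct (bounded_away (fun t => - f_fun mu u t) (- (1 + u) ^ 2) (- (u ^ 2 + u + 1 / 6)))
      as (d & Hd & Hdt).
    + intros t. apply (continuous_opp (f_fun mu u)). now apply continuous_f_fun.
    + intros t. generalize (f_fun_lt_high mu u t Hmu Hu). lra.
    + apply (is_lim_opp (f_fun mu u) p_infty (u ^ 2 + u + 1 / 6)). now apply is_lim_f_fun.
    + nra.
    + assert (M <= - d).
      { apply H2. intros t Ht. specialize (Hdt t Ht). lra. }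
      lra.
Qed.

(** ** Two-sided bounds *)

Lemma bound_low_iff mu u t a : 0 < mu -> 0 <= u -> 0 < t -> 0 <= a ->
  (1 / (mu * Rpower (t ^ 2 + a) mu) <= Ssum mu t u <-> f_fun mu u t <= a).
Proof.
  intros Hmu Hu Ht Ha. rewrite bound_npow, Ssum_Sg, f_fun_Ff.
  symmetry. apply Ff_le_iff; auto; nra.
Qed.

Lemma bound_high_iff mu u t b : 0 < mu -> 0 <= u -> 0 < t -> 0 <= b ->
  (Ssum mu t u <= 1 / (mu * Rpower (t ^ 2 + b) mu) <-> b <= f_fun mu u t).
Proof.
  intros Hmu Hu Ht Ha. rewrite bound_npow, Ssum_Sg, f_fun_Ff.
  symmetry. apply Ff_ge_iff; auto; nra.
Qed.

Lemma bound_low_strict mu u t a : 0 < mu -> 0 <= u -> 0 < a ->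
  f_fun mu u t < a -> 1 / (mu * Rpower (t ^ 2 + a) mu) < Ssum mu t u.
Proof.
  intros Hmu Hu Ha H. rewrite bound_npow, Ssum_Sg. rewrite f_fun_Ff in H.
  apply Ff_lt_iff; auto; nra.
Qed.

Lemma bound_high_strict mu u t b : 0 < mu -> 0 <= u -> 0 < b ->
  b < f_fun mu u t -> Ssum mu t u < 1 / (mu * Rpower (t ^ 2 + b) mu).
Proof.
  intros Hmu Hu Ha H. rewrite bound_npow, Ssum_Sg. rewrite f_fun_Ff in H.
  apply Ff_gt_iff; auto; nra.
Qed.

Lemma extend_to_0 (phi : R -> R) c : continuous phi 0 ->
  (forall t, 0 < t -> c <= phi t) -> forall t, 0 <= t -> c <= phi t.
Proof.
  intros Hc H t Ht. destruct (Rle_lt_or_eq_dec 0 t Ht) as [H0|<-]; auto.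
  destruct (Rle_lt_dec c (phi 0)) as [Hle|Hlt]; auto. exfalso.
  assert (He : 0 < c - phi 0) by lra.
  apply continuity_pt_filterlim in Hc.
  destruct (Hc (c - phi 0) He) as (d & Hd & Hdd).
  specialize (Hdd (d / 2)). unfold dist in Hdd; simpl in Hdd. unfold R_dist in Hdd.
  rewrite Rminus_0_r in Hdd.
  assert (Hlt2 : Rabs (phi (d / 2) - phi 0) < c - phi 0).
  { apply Hdd. split; [split; [exact I|lra]|]. rewrite Rabs_pos_eq; lra. }
  specialize (H (d / 2) ltac:(lra)). apply Rabs_lt_between in Hlt2. lra.
Qed.

Lemma bounds_iff mu u a b : 0 < mu -> 0 <= u -> 0 <= a -> 0 <= b ->
  ((forall t : R, 0 < t ->
      1 / (mu * Rpower (t ^ 2 + a) mu) <= Ssum mu t u /\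
      Ssum mu t u <= 1 / (mu * Rpower (t ^ 2 + b) mu))
   <->
   ((0 <= b /\ Rbar_le (Finite b) (m_inf mu u)) /\ Rbar_le (M_sup mu u) (Finite a))).
Proof.
  intros Hmu Hu Ha Hb.
  destruct (m_inf_spec mu u Hmu Hu) as (m & -> & Hm1 & Hm2).
  destruct (M_sup_spec mu u Hmu Hu) as (M & -> & HM1 & HM2).
  simpl. split.
  - intros H. repeat split; auto.
    + apply Hm2. apply extend_to_0; [now apply continuous_f_fun|].
      intros t Ht. apply bound_high_iff; auto. now apply H.
    + apply HM2. intros t Ht. apply Ropp_le_cancel. revert t Ht.
      apply (extend_to_0 (fun t => - f_fun mu u t)).
      * apply (continuous_opp (f_fun mu u)). now apply continuous_f_fun.
      * intros t Ht. apply Ropp_le_contravar. apply bound_low_iff; auto. now apply H.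
  - intros [[_ H1] H2] t Ht. split.
    + apply bound_low_iff; auto. specialize (HM1 t ltac:(lra)). lra.
    + apply bound_high_iff; auto. specialize (Hm1 t ltac:(lra)). lra.
Qed.

Lemma extrema_monotone mu nu u : 0 < mu -> mu < nu -> 0 <= u ->
  Rbar_le (m_inf nu u) (m_inf mu u) /\ Rbar_le (M_sup mu u) (M_sup nu u).
Proof.
  intros Hmu Hnu Hu.
  destruct (m_inf_range mu u Hmu Hu) as (m & -> & _ & _ & Hm).
  destruct (m_inf_range nu u ltac:(lra) Hu) as (m' & -> & Hm'0 & Hm' & _).
  destruct (M_sup_range mu u Hmu Hu) as (M & -> & _ & _ & HM).
  destruct (M_sup_range nu u ltac:(lra) Hu) as (M' & -> & HM'0 & HM' & _).
  assert (Hsq : forall s, 0 <= s -> f_fun nu u (sqrt s) = Ff nu u s).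
  { intros s Hs. rewrite f_fun_Ff, pow2_sqrt; auto. }
  simpl. split.
  - apply Hm. intros t Ht. rewrite f_fun_Ff.
    apply (Ff_ge_descend mu nu); auto; [nra|nra|].
    intros r Hr. rewrite <- Hsq by nra. apply Hm', sqrt_pos.
  - apply HM. intros t Ht. rewrite f_fun_Ff.
    apply (Ff_le_descend mu nu); auto; [nra|nra|].
    intros r Hr. rewrite <- Hsq by nra. apply HM', sqrt_pos.
Qed.

(** * Monotonicity in [t] *)

Lemma decreasing_gt_lim nu u T : 0 < nu -> 0 <= u -> 0 <= T ->
  (forall a b, T <= a -> a < b -> f_fun nu u b < f_fun nu u a) ->
  forall t, T <= t -> u ^ 2 + u + 1 / 6 < f_fun nu u t.
Proof.
  intros Hnu Hu HT Hdec t Ht.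
  apply Rle_lt_trans with (f_fun nu u (t + 1)); [|apply Hdec; lra].
  apply (is_lim_le_loc (f_fun nu u) (fun _ => f_fun nu u (t + 1)) p_infty
           (u ^ 2 + u + 1 / 6) (f_fun nu u (t + 1))).
  - exists (t + 1). intros s Hs. left. apply Hdec; lra.
  - now apply is_lim_f_fun.
  - apply is_lim_const.
Qed.

Lemma f_fun_pos mu u t : 0 < mu -> 0 <= u -> 0 < f_fun mu u t.
Proof. intros Hmu Hu. generalize (f_fun_gt_low mu u t Hmu Hu). nra. Qed.

Lemma bounds_of_decreasing nu u T : 0 < nu -> 0 <= u -> 0 <= T ->
  (forall a b, T <= a -> a < b -> f_fun nu u b < f_fun nu u a) ->
  forall t, T < t ->
    1 / (nu * Rpower (t ^ 2 + f_fun nu u T) nu) < Ssum nu t u /\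
    Ssum nu t u < 1 / (nu * Rpower (t ^ 2 + f_infty nu u) nu).
Proof.
  intros Hnu Hu HT Hdec t Ht. rewrite f_infty_eq by auto. split.
  - apply bound_low_strict; auto; [now apply f_fun_pos|]. apply Hdec; lra.
  - apply bound_high_strict; auto; [nra|].
    apply (decreasing_gt_lim nu u T); auto. lra.
Qed.

Lemma eventually_decreasing nu u : 0 < nu -> 0 <= u ->
  exists t0 : R, 0 <= t0 /\
    (forall t : R, t0 < t -> ex_derive (f_fun nu u) t /\ Derive (f_fun nu u) t < 0) /\
    (forall t : R, t0 < t ->
       1 / (nu * Rpower (t ^ 2 + f_fun nu u t0) nu) < Ssum nu t u /\
       Ssum nu t u < 1 / (nu * Rpower (t ^ 2 + f_infty nu u) nu)).
Proof.
  intros Hnu Hu. destruct (Gf_lt_succ_eventually nu u Hnu Hu) as (T & HT & HG).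
  assert (Hneg : forall t, T < t ->
    2 * t * (npow (nu + 1) (Gf (nu + 1) u (t ^ 2) / Gf nu u (t ^ 2)) - 1) < 0).
  { intros t Ht.
    assert (npow (nu + 1) (Gf (nu + 1) u (t ^ 2) / Gf nu u (t ^ 2)) - 1 < 0).
    { apply npow_ratio_lt; try apply Gf_pos; [lra|]. apply HG. lra. }
    nra. }
  exists T. split; [lra|]. split.
  - intros t Ht. assert (D := is_derive_f_fun nu u t Hnu Hu). split.
    + eexists; exact D.
    + rewrite (is_derive_unique _ _ _ D). now apply Hneg.
  - apply bounds_of_decreasing; auto; [lra|].
    intros a b Ha Hab.
    destruct (mean_value (f_fun nu u) _ a b Hab
      (fun c _ => is_derive_f_fun nu u c Hnu Hu)) as (c & Hc & Hcab).
    assert (Hn := Hneg c ltac:(lra)). nra.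
Qed.

(** The derivative of [F_nu] vanishes only where [G_{nu+1} = G_nu]. *)
Lemma Ff_constant_succ nu u b s1 s2 : 0 < nu -> 0 <= u -> 0 <= s1 ->
  (forall s, s1 < s < s2 -> Ff nu u s = b) ->
  forall s, s1 < s < s2 -> Ff (nu + 1) u s = b.
Proof.
  intros Hnu Hu Hs1 H s Hs.
  assert (D := is_derive_Ff nu u s Hnu Hu ltac:(lra)).
  assert (D0 : is_derive (Ff nu u) s 0).
  { apply (is_derive_ext_loc (fun _ => b)); [|apply @is_derive_const].
    assert (He : 0 < Rmin (s - s1) (s2 - s)) by (apply Rmin_pos; lra).
    exists (mkposreal _ He). intros y Hy. symmetry. apply H.
    change (Rabs (y - s) < Rmin (s - s1) (s2 - s)) in Hy. apply Rabs_lt_between in Hy.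
    generalize (Rmin_l (s - s1) (s2 - s)) (Rmin_r (s - s1) (s2 - s)). lra. }
  apply is_derive_unique in D. apply is_derive_unique in D0.
  assert (E : npow (nu + 1) (Gf (nu + 1) u s / Gf nu u s) - 1 = 0) by congruence.
  rewrite <- (H s Hs). unfold Ff. f_equal.
  assert (P1 := Gf_pos nu u s). assert (P2 := Gf_pos (nu + 1) u s).
  destruct (Rtotal_order (Gf (nu + 1) u s) (Gf nu u s)) as [Hlt|[Heq|Hgt]]; auto; exfalso.
  - assert (npow (nu + 1) 1 < npow (nu + 1) (Gf (nu + 1) u s / Gf nu u s)).
    { apply npow_lt; [lra|]. split; [now apply Rdiv_lt_0_compat|].
      apply (Rmult_lt_reg_r (Gf nu u s)); auto.
      unfold Rdiv. rewrite Rmult_assoc, Rinv_l; lra. }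
    rewrite npow_base_1 in H0. lra.
  - apply Rgt_lt in Hgt. apply (npow_ratio_lt (nu + 1)) in Hgt; auto; lra.
Qed.

Lemma Sg_first_term mu u s : 0 < mu -> 0 <= u -> 0 <= s ->
  mu * Sg mu u s <= (2 * (1 + u) * mu + 1) * npow mu (s + (1 + u) ^ 2).
Proof.
  intros Hmu Hu Hs. rewrite Sg_shift by lra.
  destruct (Sg_midpoint mu (u + 1) s) as [_ H]; auto; [lra|nra|].
  unfold mterm. rewrite pt_0. set (z := s + (1 + u) ^ 2). assert (Hz : 1 <= z) by (unfold z; nra).
  replace ((1 + u) ^ 2 + s) with z by (unfold z; ring).
  rewrite npow_succ by lra. assert (Hn := npow_pos mu z).
  assert (H1 : npow mu (s + ((u + 1) ^ 2 + (u + 1))) <= npow mu z).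
  { apply npow_le; auto. split; [lra|]. unfold z. nra. }
  assert (H2 : mu * Sg mu (u + 1) s <= npow mu z).
  { apply Rle_trans with (mu * (npow mu (s + ((u + 1) ^ 2 + (u + 1))) / mu)).
    - apply Rmult_le_compat_l; lra.
    - replace (mu * (npow mu (s + ((u + 1) ^ 2 + (u + 1))) / mu))
        with (npow mu (s + ((u + 1) ^ 2 + (u + 1)))) by (field; lra).
      exact H1. }
  assert (H3 : mu * (2 * (1 + u) * (npow mu z / z)) <= 2 * (1 + u) * mu * npow mu z).
  { replace (mu * (2 * (1 + u) * (npow mu z / z))) with (2 * (1 + u) * mu * (npow mu z / z))
      by (field; lra).
    apply Rmult_le_compat_l.
    - apply Rmult_le_pos; lra.
    - apply Rle_div_l; [lra|]. nra. }
  lra.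
Qed.

Lemma exp_ge_sqr x : 0 <= x -> (1 + x / 2) ^ 2 <= exp x.
Proof.
  intros Hx. replace x with (x / 2 + x / 2) at 2 by field. rewrite exp_plus.
  assert (H := exp_ineq1_le (x / 2)). simpl. rewrite Rmult_1_r.
  apply Rmult_le_compat; lra.
Qed.

(** As the exponent grows, [F] tends to [(1 + u) ^ 2], since the first term of the series
    dominates, whereas each [F] lies strictly below [(1 + u) ^ 2]. *)
Lemma Ff_not_constant_in_mu nu u s b : 0 < nu -> 0 <= u -> 0 <= s ->
  ~ (forall n, Ff (nu + INR n) u s = b).
Proof.
  intros Hnu Hu Hs H.
  assert (H0 := H 0%nat). simpl in H0. rewrite Rplus_0_r in H0.
  assert (Hb1 := Ff_gt_low nu u s Hnu Hu Hs). assert (Hb2 := Ff_lt_high nu u s Hnu Hu Hs).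
  rewrite H0 in Hb1, Hb2. assert (Hb : 0 < b) by nra.
  set (z := s + (1 + u) ^ 2). assert (Hz : s + b < z) by (unfold z; lra).
  set (l := ln (z / (s + b))).
  assert (Hl : 0 < l).
  { unfold l. rewrite <- ln_1. apply ln_increasing; [lra|].
    apply (Rmult_lt_reg_r (s + b)); [lra|]. unfold Rdiv. rewrite Rmult_assoc, Rinv_l; lra. }
  (* Large enough for [(1 + mu * l / 2) ^ 2] to exceed [2 * (1 + u) * mu + 1]. *)
  destruct (nfloor_ex (8 * (1 + u) / l ^ 2)) as [n [_ Hn]].
  { apply Rdiv_le_0_compat; [lra|]. apply pow_lt; lra. }
  rewrite <- S_INR in Hn. specialize (H (S n)).
  set (mu := nu + INR (S n)) in *. assert (Hmun : INR (S n) < mu) by (unfold mu; lra).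
  assert (HnP := pos_INR (S n)). assert (Hmu : 0 < mu) by lra.
  assert (HG : Gf mu u s = s + b) by (unfold Ff in H; lra).
  assert (E := npow_Gf mu u s Hmu Hu ltac:(lra)). rewrite HG in E.
  assert (HS := Sg_first_term mu u s Hmu Hu Hs). fold z in HS. rewrite <- E in HS.
  assert (Hexp : exp (mu * l) <= 2 * (1 + u) * mu + 1).
  { apply (Rmult_le_reg_r (npow mu z)); [apply npow_pos|].
    eapply Rle_trans; [|exact HS]. right.
    unfold l, npow, Rpower. rewrite <- exp_plus, ln_div by lra. f_equal. ring. }
  assert (Hsq := exp_ge_sqr (mu * l) ltac:(nra)).
  assert (Hlarge : 8 * (1 + u) < mu * l ^ 2).
  { assert (H1 : 8 * (1 + u) / l ^ 2 < mu) by lra.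
    assert (Hl2 : 0 < l ^ 2) by (apply pow_lt; lra).
    apply (Rmult_lt_compat_r (l ^ 2)) in H1; auto.
    unfold Rdiv in H1. rewrite Rmult_assoc, Rinv_l in H1; lra. }
  assert (0 < mu * l) by nra.
  assert (mu * (8 * (1 + u)) < mu * (mu * l ^ 2)) by (apply Rmult_lt_compat_l; lra).
  nra.
Qed.

(** A nonincreasing function that is not strictly decreasing is constant on an interval, and
    then so are all the [F] of exponents [nu + n], with the same value. *)
Lemma Ff_strictly_decreasing nu u : 0 < nu -> 0 <= u ->
  (forall s, 0 <= s -> Gf nu u s <= Gf (nu + 1) u s) ->
  forall s1 s2, 0 <= s1 < s2 -> Ff nu u s2 < Ff nu u s1.
Proof.
  intros Hnu Hu HG.
  assert (Hle : forall s1 s2, 0 <= s1 <= s2 -> Ff nu u s2 <= Ff nu u s1).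
  { intros s1 s2 Hs. destruct (Rle_lt_or_eq_dec s1 s2) as [H|<-]; [lra| |lra].
    destruct (mean_value (Ff nu u) _ s1 s2 H
      (fun c Hc => is_derive_Ff nu u c Hnu Hu ltac:(lra))) as (c & Hc & Hcs).
    assert (Hn : npow (nu + 1) (Gf (nu + 1) u c / Gf nu u c) - 1 <= 0).
    { apply npow_ratio_le; try apply Gf_pos; [lra|]. apply HG. lra. }
    nra. }
  intros s1 s2 Hs. destruct (Rlt_le_dec (Ff nu u s2) (Ff nu u s1)) as [H|H]; auto.
  exfalso.
  assert (Hconst : forall s, s1 < s < s2 -> Ff nu u s = Ff nu u s1).
  { intros s Hss. assert (H1 := Hle s1 s ltac:(lra)). assert (H2 := Hle s s2 ltac:(lra)). lra. }
  apply (Ff_not_constant_in_mu nu u ((s1 + s2) / 2) (Ff nu u s1)); auto; [lra|].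
  assert (Hall : forall n s, s1 < s < s2 -> Ff (nu + INR n) u s = Ff nu u s1).
  { induction n as [|n IH]; intros s Hss.
    - simpl. rewrite Rplus_0_r. auto.
    - rewrite S_INR, <- Rplus_assoc. apply (Ff_constant_succ (nu + INR n) u _ s1 s2); auto.
      + generalize (pos_INR n). lra.
      + lra. }
  intros n. apply Hall. lra.
Qed.

(** ** The derivative of [(t ^ 2 + a) ^ mu * S_mu] *)

Lemma is_derive_weighted mu u a t : 0 < mu -> 0 <= u -> 0 <= a -> 0 < t ->
  is_derive (fun s : R => Rpower (s ^ 2 + a) mu * Ssum mu s u) t
    (2 * t * npow (1 - mu) (t ^ 2 + a)
     * (mu * Sg mu u (t ^ 2) - (t ^ 2 + a) * ((mu + 1) * Sg (mu + 1) u (t ^ 2)))).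
Proof.
  intros Hmu Hu Ha Ht. assert (Hz : 0 < t ^ 2 + a) by nra.
  apply (is_derive_ext (fun s => npow (- mu) (s ^ 2 + a) * Sg mu u (s ^ 2))).
  { intros s. rewrite Ssum_Sg. unfold npow. now rewrite Ropp_involutive. }
  assert (D1 : is_derive (fun s => npow (- mu) (s ^ 2 + a)) t
                 (2 * t * (- - mu * npow (- mu + 1) (t ^ 2 + a)))).
  { apply (is_derive_comp (npow (- mu)) (fun s => s ^ 2 + a)).
    - now apply is_derive_npow.
    - auto_derive; auto. ring. }
  assert (D2 : is_derive (fun s => Sg mu u (s ^ 2)) t
                 (2 * t * (- (mu + 1) * Sg (mu + 1) u (t ^ 2)))).
  { apply (is_derive_comp (Sg mu u) (fun s => s ^ 2)).
    - apply is_derive_Sg; auto. nra.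
    - auto_derive; auto. ring. }
  evar_last; [exact (is_derive_mult _ _ _ _ _ D1 D2 Rmult_comm)|].
  unfold plus, mult; simpl.
  replace (1 - mu) with (- mu + 1) by ring.
  replace (npow (- mu) (t * (t * 1) + a))
    with (npow (- mu + 1) (t * (t * 1) + a) * (t * (t * 1) + a)).
  - ring.
  - simpl in Hz. rewrite npow_succ by lra. field. lra.
Qed.

Lemma log_slope_pos nu u s a : 0 < nu -> 0 <= u -> 0 <= s -> 0 <= a ->
  Gf nu u s <= Gf (nu + 1) u s -> a < Ff nu u s ->
  0 < nu * Sg nu u s - (s + a) * ((nu + 1) * Sg (nu + 1) u s).
Proof.
  intros Hnu Hu Hs Ha HG HF. unfold Ff in HF.
  assert (P1 := Gf_pos nu u s).
  rewrite <- (npow_Gf nu), <- (npow_Gf (nu + 1)) by lra.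
  assert (H1 : npow (nu + 1) (Gf (nu + 1) u s) <= npow (nu + 1) (Gf nu u s))
    by (apply npow_le; lra).
  assert (Hn := npow_pos (nu + 1) (Gf nu u s)).
  replace (npow nu (Gf nu u s)) with (npow (nu + 1) (Gf nu u s) * Gf nu u s)
    by (rewrite npow_succ by auto; field; lra).
  assert (0 < npow (nu + 1) (Gf nu u s) * (Gf nu u s - (s + a)))
    by (apply Rmult_lt_0_compat; lra).
  assert ((s + a) * npow (nu + 1) (Gf (nu + 1) u s) <= (s + a) * npow (nu + 1) (Gf nu u s))
    by (apply Rmult_le_compat_l; lra).
  lra.
Qed.

Lemma m_inf_eq_limit mu u : 0 < mu -> 0 <= u ->
  (forall t, 0 <= t -> u ^ 2 + u + 1 / 6 < f_fun mu u t) ->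
  m_inf mu u = Finite (u ^ 2 + u + 1 / 6).
Proof.
  intros Hmu Hu H. destruct (m_inf_range mu u Hmu Hu) as (m & -> & [_ H1] & _ & H2).
  f_equal. apply Rle_antisym; auto. apply H2. intros t Ht. left. auto.
Qed.

Lemma Gf_Rpower mu u t : Gf mu u (t ^ 2) = / Rpower (mu * Ssum mu t u) (1 / mu).
Proof. unfold Gf. now rewrite npow_inv, Ssum_Sg. Qed.

(** ** Consequences of [G_nu <= G_{nu+1}] *)

Section Comparison.

Variables nu u : R.
Hypothesis Hnu : 0 < nu.
Hypothesis Hu : 0 <= u.
Hypothesis Hcmp : forall t : R, 0 <= t ->
  Rpower ((nu + 1) * Ssum (nu + 1) t u) (1 / (nu + 1)) <= Rpower (nu * Ssum nu t u) (1 / nu).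

Lemma cmp_Gf s : 0 <= s -> Gf nu u s <= Gf (nu + 1) u s.
Proof.
  intros Hs. rewrite <- (pow2_sqrt s) by auto. rewrite !Gf_Rpower.
  apply Rinv_le_contravar; [apply exp_pos|]. apply Hcmp, sqrt_pos.
Qed.

Lemma cmp_decreasing s t : 0 <= s -> s < t -> f_fun nu u t < f_fun nu u s.
Proof.
  intros Hs Hst. rewrite !f_fun_Ff. apply Ff_strictly_decreasing; auto.
  - apply cmp_Gf.
  - nra.
Qed.

Lemma cmp_Ff_gt s : 0 <= s -> u ^ 2 + u + 1 / 6 < Ff nu u s.
Proof.
  intros Hs. rewrite <- (pow2_sqrt s) by auto. rewrite <- f_fun_Ff.
  apply (decreasing_gt_lim nu u 0); auto; [lra| |apply sqrt_pos].
  intros. now apply cmp_decreasing.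
Qed.

Lemma cmp_Ff_gt_all mu s : 0 < mu -> mu <= nu + 1 -> 0 <= s -> u ^ 2 + u + 1 / 6 < Ff mu u s.
Proof.
  intros Hmu Hle Hs.
  assert (H1 : forall s, 0 <= s -> u ^ 2 + u + 1 / 6 < Ff (nu + 1) u s).
  { intros s' Hs'. eapply Rlt_le_trans; [exact (cmp_Ff_gt s' Hs')|].
    assert (H := cmp_Gf s' Hs'). unfold Ff. lra. }
  destruct (Rle_lt_or_eq_dec _ _ Hle) as [H| ->]; auto.
  apply (Ff_gt_descend mu (nu + 1)); auto; [nra|].
  intros r Hr. apply H1. lra.
Qed.

Lemma cmp_extrema :
  (forall s t : R, 0 <= s -> s < t -> f_fun nu u t < f_fun nu u s) /\
  (forall t : R, 0 < t ->
     1 / (nu * Rpower (t ^ 2 + f_fun nu u 0) nu) < Ssum nu t u /\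
     Ssum nu t u < 1 / (nu * Rpower (t ^ 2 + f_infty nu u) nu)) /\
  M_sup nu u = Finite (f_fun nu u 0) /\
  (forall mu : R, 0 < mu -> mu <= nu + 1 ->
     m_inf mu u = Finite (u ^ 2 + u + 1 / 6) /\
     (forall t : R, 0 <= t ->
        Ssum mu t u < 1 / (mu * Rpower (t ^ 2 + real (m_inf mu u)) mu))).
Proof.
  split; [exact cmp_decreasing|]. split.
  { intros t Ht. apply bounds_of_decreasing; auto; [lra|]. intros. now apply cmp_decreasing. }
  split.
  - destruct (M_sup_spec nu u Hnu Hu) as (M & -> & H1 & H2). f_equal.
    apply Rle_antisym; [|apply H1; lra]. apply H2. intros t Ht.
    destruct (Rle_lt_or_eq_dec _ _ Ht) as [H|<-]; [|lra]. left. apply cmp_decreasing; lra.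
  - intros mu Hmu Hle.
    assert (Hf : forall t, 0 <= t -> u ^ 2 + u + 1 / 6 < f_fun mu u t).
    { intros t Ht. rewrite f_fun_Ff. apply cmp_Ff_gt_all; auto. nra. }
    rewrite (m_inf_eq_limit mu u) by auto. split; auto.
    intros t Ht. apply bound_high_strict; auto. simpl. nra.
Qed.

Lemma cmp_weighted mu a t : 0 < mu -> mu <= nu -> 0 <= a -> a <= u ^ 2 + u + 1 / 6 -> 0 < t ->
  ex_derive (fun s : R => Rpower (s ^ 2 + a) mu * Ssum mu s u) t /\
  0 < Derive (fun s : R => Rpower (s ^ 2 + a) mu * Ssum mu s u) t.
Proof.
  intros Hmu Hle Ha Ha1 Ht.
  assert (D := is_derive_weighted mu u a t Hmu Hu Ha Ht).
  split; [eexists; exact D|]. rewrite (is_derive_unique _ _ _ D).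
  assert (Hnu_pos : forall s, 0 <= s ->
    0 < nu * Sg nu u s - (s + a) * ((nu + 1) * Sg (nu + 1) u s)).
  { intros s Hs. apply log_slope_pos; auto; [now apply cmp_Gf|].
    eapply Rle_lt_trans; [exact Ha1|]. exact (cmp_Ff_gt s Hs). }
  apply Rmult_lt_0_compat.
  - apply Rmult_lt_0_compat; [lra|apply npow_pos].
  - destruct (Rle_lt_or_eq_dec _ _ Hle) as [H| ->]; [|apply Hnu_pos; nra].
    apply (log_slope_descend mu nu); auto; [nra|].
    intros r Hr. apply Hnu_pos. nra.
Qed.

End Comparison.

Lemma comparison_1_0 t : 0 <= t ->
  Rpower ((1 + 1) * Ssum (1 + 1) t 0) (1 / (1 + 1)) <= Rpower (1 * Ssum 1 t 0) (1 / 1).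
Proof.
  intros Ht. rewrite !Ssum_Sg. assert (Hs : 0 <= t ^ 2) by nra.
  assert (P1 := Sg_pos 1 0 (t ^ 2) ltac:(lra) ltac:(lra) ltac:(lra)).
  assert (P2 := Sg_pos (1 + 1) 0 (t ^ 2) ltac:(lra) ltac:(lra) ltac:(lra)).
  assert (H := Sg_2_le_sqr (t ^ 2) Hs).
  rewrite Rmult_1_l. replace (1 / 1) with 1 by field. rewrite Rpower_1 by auto.
  apply Rle_trans with (Rpower (Sg 1 0 (t ^ 2) ^ 2) (1 / (1 + 1))).
  - apply Rle_Rpower_l; [lra|]. split; [lra|]. replace (1 + 1) with 2 at 1 by ring. exact H.
  - right. replace (Sg 1 0 (t ^ 2) ^ 2) with (Rpower (Sg 1 0 (t ^ 2)) (INR 2))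
      by (now apply Rpower_pow).
    rewrite Rpower_mult. replace (INR 2 * (1 / (1 + 1))) with 1 by (simpl; field).
    now apply Rpower_1.
Qed.

Theorem theorem2p8 :
  (forall mu u : R, 0 < mu -> 0 <= u ->
     is_lim (f_fun mu u) p_infty (Finite (u ^ 2 + u + 1 / 6)) /\
     (Rbar_lt (Finite 0) (m_inf mu u) /\
      Rbar_le (m_inf mu u) (M_sup mu u) /\
      Rbar_lt (M_sup mu u) p_infty) /\
     (forall a b : R, 0 <= a -> 0 <= b ->
        ((forall t : R, 0 < t ->
            1 / (mu * Rpower (t ^ 2 + a) mu) <= Ssum mu t u /\
            Ssum mu t u <= 1 / (mu * Rpower (t ^ 2 + b) mu))
         <->
         ((0 <= b /\ Rbar_le (Finite b) (m_inf mu u)) /\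
          Rbar_le (M_sup mu u) (Finite a))))) /\
  (* (1) *)
  (forall mu u : R, 0 < mu -> 0 <= u ->
     Rbar_lt (Finite (u ^ 2 + u)) (m_inf mu u) /\
     Rbar_le (m_inf mu u) (Finite (u ^ 2 + u + 1 / 6)) /\
     u ^ 2 + u + 1 / 6 < u ^ 2 + u + 1 / 4 /\
     Rbar_lt (Finite (u ^ 2 + u + 1 / 4)) (M_sup mu u) /\
     Rbar_lt (M_sup mu u) (Finite ((1 + u) ^ 2))) /\
  (* (2) *)
  (forall mu nu u : R, 0 < mu -> mu < nu -> 0 <= u ->
     Rbar_le (m_inf nu u) (m_inf mu u) /\
     Rbar_le (M_sup mu u) (M_sup nu u)) /\
  (* (3) *)
  (forall nu u : R, 0 < nu -> 0 <= u ->
     exists t0 : R, 0 <= t0 /\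
       (forall t : R, t0 < t ->
          ex_derive (f_fun nu u) t /\ Derive (f_fun nu u) t < 0) /\
       (forall t : R, t0 < t ->
          1 / (nu * Rpower (t ^ 2 + f_fun nu u t0) nu) < Ssum nu t u /\
          Ssum nu t u < 1 / (nu * Rpower (t ^ 2 + f_infty nu u) nu))) /\
  (* (4) *)
  (forall nu u : R, 0 < nu -> 0 <= u ->
     (forall t : R, 0 <= t ->
        Rpower ((nu + 1) * Ssum (nu + 1) t u) (1 / (nu + 1))
        <= Rpower (nu * Ssum nu t u) (1 / nu)) ->
     (* (4.1) *)
     ((forall s t : R, 0 <= s -> s < t -> f_fun nu u t < f_fun nu u s) /\
      (forall t : R, 0 < t ->
         1 / (nu * Rpower (t ^ 2 + f_fun nu u 0) nu) < Ssum nu t u /\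
         Ssum nu t u < 1 / (nu * Rpower (t ^ 2 + f_infty nu u) nu)) /\
      M_sup nu u = Finite (f_fun nu u 0) /\
      (forall mu : R, 0 < mu -> mu <= nu + 1 ->
         m_inf mu u = Finite (u ^ 2 + u + 1 / 6) /\
         (forall t : R, 0 <= t ->
            Ssum mu t u < 1 / (mu * Rpower (t ^ 2 + real (m_inf mu u)) mu)))) /\
     (* (4.2) *)
     (forall mu a : R, 0 < mu -> mu <= nu -> 0 <= a -> a <= u ^ 2 + u + 1 / 6 ->
        forall t : R, 0 < t ->
          ex_derive (fun s : R => Rpower (s ^ 2 + a) mu * Ssum mu s u) t /\
          0 < Derive (fun s : R => Rpower (s ^ 2 + a) mu * Ssum mu s u) t)) /\
  (* (5.1) *)
  (forall mu : R, 0 < mu -> mu <= 2 ->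
     m_inf mu 0 = Finite (1 / 6) /\
     (forall t : R, 0 <= t ->
        Ssum mu t 0 < 1 / (mu * Rpower (t ^ 2 + 1 / 6) mu))) /\
  (* (5.2) *)
  (forall mu a : R, 0 < mu -> mu <= 1 -> 0 <= a -> a <= 1 / 6 ->
     forall t : R, 0 < t ->
       ex_derive (fun s : R => Rpower (s ^ 2 + a) mu * Ssum mu s 0) t /\
       0 < Derive (fun s : R => Rpower (s ^ 2 + a) mu * Ssum mu s 0) t).
Proof.
  split; [|split; [|split; [|split; [|split; [|split]]]]].
  - intros mu u Hmu Hu. split; [now apply is_lim_f_fun|]. split.
    + destruct (m_inf_range mu u Hmu Hu) as (m & -> & Hm & Hm' & _).
      destruct (M_sup_range mu u Hmu Hu) as (M & -> & HM & HM' & _).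
      simpl. split; [nra|]. split; auto.
      specialize (Hm' 0 ltac:(lra)). specialize (HM' 0 ltac:(lra)). lra.
    + intros a b. now apply bounds_iff.
  - intros mu u Hmu Hu.
    destruct (m_inf_range mu u Hmu Hu) as (m & -> & Hm & _).
    destruct (M_sup_range mu u Hmu Hu) as (M & -> & HM & _).
    simpl in *. repeat split; lra.
  - exact extrema_monotone.
  - exact eventually_decreasing.
  - intros nu u Hnu Hu Hcmp. split.
    + now apply cmp_extrema.
    + intros mu a Hmu Hle Ha Ha1 t Ht. now apply (cmp_weighted nu).
  - intros mu Hmu Hle.
    destruct (cmp_extrema 1 0 ltac:(lra) ltac:(lra) comparison_1_0) as (_ & _ & _ & H).
    specialize (H mu Hmu ltac:(lra)).
    replace (0 ^ 2 + 0 + 1 / 6) with (1 / 6) in H by ring.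
    destruct H as [E H]. rewrite E in H. now split.
  - intros mu a Hmu Hle Ha Ha1 t Ht.
    apply (cmp_weighted 1 0 ltac:(lra) ltac:(lra) comparison_1_0); auto; lra.
Qed.
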